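(* Let $\mathcal{B}$ be a locally finite thick affine building of type $\tilde A_2$ of order $q$, and let $\Gamma$ be a group of type rotating automorphisms of $\mathcal{B}$ acting freely and with finitely many orbits on the vertices of $\mathcal{B}$. Let $A$ be the finite alphabet of $\Gamma$-orbits of tiles and $W=\bigcup_m W_m$ the set of words, with maps $o,t:W\to A$ and shape $\sigma(u)\in\mathbb{Z}_{\geq 0}^2$ of $u\in W$. Then every choice of nonnegative real numbers $\{\tilde g(v)\in\mathbb{R}_+ : v\in A\}$ determines a function $\tilde g:W\to\mathbb{R}_+$ given by $$\tilde g(u)=q^{-2(m_1+m_2)}\,\tilde g(o(u)),\qquad (m_1,m_2)=\sigma(u),$$ which satisfies, for both $i=1$ and $i=2$ and for all $u\in W$, $$\tilde g(u)=\sum_{\substack{w\in W,\ \sigma(w)=e_i,\\ o(w)=t(u)}}\tilde g(uw).$$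
   Context: The building $\mathcal{B}$ is of order $q$: every edge of $\mathcal{B}$ lies in exactly $q+1$ chambers (triangles). Vertices have types in $\mathbb{Z}/3$; an automorphism or isometry is type rotating if it changes all types by a fixed cyclic shift $i\mapsto i+c$. Model apartment: take a Coxeter complex of type $\tilde A_2$ (the Euclidean plane tessellated by equilateral triangles), fix a vertex of type $0$ as origin, and coordinatize its vertices by $\mathbb{Z}^2$ using as axes two of the three walls through the origin, so that the nonnegative quadrant is a $\pi/3$-angled sector. For $m=(m_1,m_2)\in\mathbb{Z}_{\geq0}^2$, let $\mathfrak{p}_m$ be the parallelogram based at $(0,0)$ spanned by $(m_1+1,0)$ and $(0,m_2+1)$, and let $\mathfrak{t}=\mathfrak{p}_{(0,0)}$ be the model tile (two triangles). Let $\mathfrak{B}_m$ be the set of type rotating isometries $\mathfrak{p}_m\to\mathcal{B}$. Words of shape $m$ are the $\Gamma$-orbits: $W_m=\Gamma\backslash\mathfrak{B}_m$, $W=\bigcup_m W_m$, $A=W_{(0,0)}$, and $\sigma(u)=m$ for $u\in W_m$. For $p\in\mathfrak{B}_m$ the initial tile is $o(p)=p|_{\mathfrak{t}}$ and the terminal tile is $t(p)(l)=p(m+l)$, $l\in\mathfrak{t}$; these induce $o,t:W\to A$. Let $e_1=(1,0)$, $e_2=(0,1)$. For $u\in W_m$ and $w\in W_{e_i}$ with $o(w)=t(u)$, the product $uw\in W_{m+e_i}$ is the unique class having a representative $p'\in\mathfrak{B}_{m+e_i}$ such that $p'|_{\mathfrak{p}_m}$ represents $u$ and $l\mapsto p'(m+l)$,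 $l\in\mathfrak{p}_{e_i}$, represents $w$ (this exists and is unique). *)

(* Defs.v *)
From HB Require Import structures.
From mathcomp Require Import all_boot all_order all_algebra.
From mathcomp Require Import generic_quotient.
From mathcomp Require Import all_classical reals.

Set Implicit Arguments.
Unset Strict Implicit.
Unset Printing Implicit Defensive.

Import Order.TTheory GRing.Theory Num.Theory.
Local Open Scope classical_set_scope.
Local Open Scope card_scope.
Local Open Scope quotient_scope.
Local Open Scope ring_scope.

(* Abstract simplicial complexes, as sets of nonempty finite simplices. *)

Definition is_complex (T : Type) (K : set (set T)) : Prop :=
  (forall s, K s -> finite_set s /\ s !=set0) /\
  (forall s s', K s -> s' `<=` s -> s' !=set0 -> K s').

Definition vertices (T : Type) (K : set (set T)) : set T :=
  \bigcup_(s in K) s.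

(* Only the values of [f] on the vertices of [K] matter. *)
Definition complex_isom (T U : Type) (K : set (set T)) (L : set (set U))
    (f : T -> U) : Prop :=
  {in vertices K &, injective f} /\ L = [set f @` s | s in K].

(* The Coxeter complex of type A~_2. The lattice point [(a, b)] stands for
   a * u1 + b * u2, where u1 and u2 are unit vectors at an angle of pi / 3. *)

Definition lattice : Type := (int * int)%type.

Definition up_triangle (x : lattice) : set lattice :=
  [set x; (x.1 + 1, x.2); (x.1, x.2 + 1)].

Definition down_triangle (x : lattice) : set lattice :=
  [set (x.1 + 1, x.2); (x.1, x.2 + 1); (x.1 + 1, x.2 + 1)].

Definition coxeter_complex : set (set lattice) :=
  [set s | s !=set0 /\
     exists x, s `<=` up_triangle x \/ s `<=` down_triangle x].

(* The three vertices of each triangle have distinct types; the origin has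
   type 0. *)
Definition model_type (x : lattice) : 'Z_3 := x.1%:~R - x.2%:~R.

(* Squared Euclidean norm of (x.1 - y.1) * u1 + (x.2 - y.2) * u2. *)
Definition model_sqdist (x y : lattice) : int :=
  let a := x.1 - y.1 in let b := x.2 - y.2 in a ^+ 2 + a * b + b ^+ 2.

Record building := Building {
  vertex : choiceType;
  simplex : set (set vertex);
  apartment : set (set (set vertex));
  vtype : vertex -> 'Z_3;
  simplex_complex : is_complex simplex;
  simplex_vertex : forall x, simplex [set x];
  apartment_nonempty : apartment !=set0;
  apartment_sub : forall S, apartment S -> S `<=` simplex;
  apartment_coxeter : forall S, apartment S ->
    exists phi : lattice -> vertex, complex_isom coxeter_complex S phi;
  apartment_cover : forall s s', simplex s -> simplex s' ->
    exists S, [/\ apartment S, S s & S s'];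
  apartment_exchange : forall S S' s s', apartment S -> apartment S' ->
    S s -> S s' -> S' s -> S' s' ->
    exists f : vertex -> vertex,
      complex_isom S S' f /\ (forall x, (s `|` s') x -> f x = x);
  vtype_inj : forall s, simplex s -> {in s &, injective vtype}
}.

Section Building.
Context (B : building).

Definition edge (e : set (vertex B)) : Prop := simplex e /\ e #= `I_2.

Definition chamber (c : set (vertex B)) : Prop := simplex c /\ c #= `I_3.

Definition thick : Prop := forall e, edge e ->
  exists c1 c2 c3, [/\ chamber c1, chamber c2 & chamber c3] /\
    [/\ e `<=` c1, e `<=` c2 & e `<=` c3] /\ [/\ c1 <> c2, c1 <> c3 & c2 <> c3].

Definition locally_finite : Prop := forall x : vertex B,
  finite_set [set s | simplex s /\ s x].

Definition of_order (q : nat) : Prop := forall e, edge e ->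
  [set c | chamber c /\ e `<=` c] #= `I_q.+1.

(* The squared distance of [B] between two vertices is read off in any
   apartment containing both of them. *)
Definition sqdist (x y : vertex B) : int :=
  xget 0 [set n | exists S phi a b,
    [/\ apartment S, complex_isom coxeter_complex S phi,
        phi a = x, phi b = y & n = model_sqdist a b]].

Definition type_rotating_automorphism (g : vertex B -> vertex B) : Prop :=
  complex_isom (@simplex B) (@simplex B) g /\
  exists c, forall x, vtype (g x) = vtype x + c.

Record rotation_group := RotationGroup {
  gset : set (vertex B -> vertex B);
  gset_auto : forall g, gset g -> type_rotating_automorphism g;
  gset_id : gset id;
  gset_comp : forall g h, gset g -> gset h -> gset (g \o h);
  gset_inv : forall g, gset g ->
    exists2 h, gset h & cancel g h /\ cancel h g
}.

Definition acts_freely (G : rotation_group) : Prop :=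
  forall g x, gset G g -> g x = x -> g = id.

Definition finitely_many_orbits (G : rotation_group) : Prop :=
  finite_set [set O | exists x, O = [set g x | g in gset G]].

End Building.

Definition shape : Type := (nat * nat)%type.
Definition shape0 : shape := (0, 0)%N.
Definition shapeD (m n : shape) : shape := (m.1 + n.1, m.2 + n.2)%N.
Definition e_ (i : 'I_2) : shape := if i == ord0 then (1, 0)%N else (0, 1)%N.

(* The vertices of the parallelogram p_m. *)
Definition pvertex (m : shape) : Type := ('I_m.1.+2 * 'I_m.2.+2)%type.

HB.instance Definition _ m := Finite.on (pvertex m).

Definition pt (m : shape) (l : pvertex m) : lattice := (l.1%:Z, l.2%:Z).

(* Translate of the vertex [l] of p_k by [s]; meaningful if the translate of
   p_k by [s] lies in p_m. *)
Definition pshift (m k s : shape) (l : pvertex k) : pvertex m :=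
  (inord (s.1 + l.1), inord (s.2 + l.2)).

Section Words.
Context (B : building).

Definition type_rotating m (p : {ffun pvertex m -> vertex B}) : Prop :=
  exists c, forall l, vtype (p l) = model_type (pt l) + c.

(* A map preserving the distances between vertices sends triangles to
   triangles, and its affine extension to p_m is isometric. *)
Definition isometric m (p : {ffun pvertex m -> vertex B}) : Prop :=
  forall l l', sqdist (p l) (p l') = model_sqdist (pt l) (pt l').

Definition isometries (m : shape) : set {ffun pvertex m -> vertex B} :=
  [set p | type_rotating p /\ isometric p].

Arguments isometries m : clear implicits.

Definition window m k s (p : {ffun pvertex m -> vertex B}) :
    {ffun pvertex k -> vertex B} := [ffun l => p (pshift m s l)].

Lemma window_isometries m k s (p : {ffun pvertex m -> vertex B}) :
  (s.1 + k.1 <= m.1)%N -> (s.2 + k.2 <= m.2)%N ->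
  isometries m p -> isometries k (window k s p).
Proof.
move=> h1 h2 [[c tp] ip].
have pE (l : pvertex k) :
    pt (pshift m s l) = (s.1%:Z + (pt l).1, s.2%:Z + (pt l).2).
  rewrite /pt /= !inordK ?PoszD //; [case: l.2|case: l.1] => i /= hi;
    rewrite ltnS in hi; rewrite ltnS.
    by apply: (leq_trans (leq_add (leqnn _) hi)); rewrite addnS ltnS.
  by apply: (leq_trans (leq_add (leqnn _) hi)); rewrite addnS ltnS.
split.
  exists (s.1%:Z%:~R - s.2%:Z%:~R + c) => l.
  have addE (V : zmodType) (a b x y z : V) :
      a + x - (b + y) + z = x - y + (a - b + z).
    by rewrite opprD addrACA [RHS]addrCA [RHS]addrA.
  by rewrite ffunE tp pE /model_type /= !rmorphD /=; apply: addE.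
move=> l l'; rewrite !ffunE ip !pE /model_sqdist /=.
by rewrite !opprD ![_ + _ + (- _ - _)]addrACA !subrr !add0r.
Qed.

Definition initial_tile m (p : isometries m) : isometries shape0.
Proof.
exists (window shape0 shape0 (val p)).
by apply/mem_set; apply: window_isometries => //; apply: (set_mem (valP p)).
Defined.

Definition terminal_tile m (p : isometries m) : isometries shape0.
Proof.
exists (window shape0 m (val p)).
apply/mem_set; apply: window_isometries; rewrite /= ?addn0 //.
exact: (set_mem (valP p)).
Defined.

Context (G : rotation_group B).

Definition same_orbit m (p p' : isometries m) : bool :=
  `[< exists2 g, gset G g & forall l, val p' l = g (val p l) >].

Lemma same_orbit_equiv m : equiv_class_of (@same_orbit m).
Proof.
split.
- by move=> p; apply/asboolP; exists id => //; apply: gset_id.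
- suff H p p' : same_orbit (m := m) p p' -> same_orbit p' p.
    by move=> p p'; apply/idP/idP => /H.
  move=> /asboolP[g Gg e]; have [h Gh [gK hK]] := gset_inv Gg.
  by apply/asboolP; exists h => // l; rewrite e gK.
- move=> p2 p1 p3 /asboolP[g Gg e] /asboolP[h Gh e'].
  apply/asboolP; exists (h \o g); first exact: gset_comp.
  by move=> l; rewrite e' e.
Qed.

Canonical same_orbit_equivRel m := EquivRelPack (same_orbit_equiv m).

Definition words_of (m : shape) : choiceType := {eq_quot @same_orbit m}.

Definition word_class m (p : isometries m) : words_of m :=
  (\pi_({eq_quot @same_orbit m}) p)%qT.

Definition word_repr m (u : words_of m) : isometries m :=
  repr (u : {eq_quot @same_orbit m}).

Definition letter : choiceType := words_of shape0.

Definition word : choiceType := {m : shape & words_of m}.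

Definition sigma (u : word) : shape := tag u.

Definition letter_word (v : letter) : word := Tagged words_of v.

Definition word_o (u : word) : letter :=
  word_class (initial_tile (word_repr (tagged u))).

Definition word_t (u : word) : letter :=
  word_class (terminal_tile (word_repr (tagged u))).

Definition is_product (u w x : word) : Prop :=
  exists p' : isometries (shapeD (sigma u) (sigma w)),
  exists p : isometries (sigma u), exists r : isometries (sigma w),
  [/\ word_class p = tagged u, val p = window (sigma u) shape0 (val p'),
      word_class r = tagged w, val r = window (sigma w) (sigma u) (val p')
    & x = Tagged words_of (word_class p')].

(* The default value [u] is irrelevant: the product exists and is unique
   whenever [sigma w = e_ i] and [word_o w = word_t u]. *)
Definition word_mul (u w : word) : word := xget u [set x | is_product u w x].

Definition extend_weight (R : realType) (q : nat) (g : letter -> R) (u : word) :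
    R := q%:R ^- (2 * ((sigma u).1 + (sigma u).2)) * g (word_o u).

End Words.

(* Main.v *)
(* The value of g~(uw) depends only on o(uw) = o(u) and on the shape of uw. So
   it suffices that each u has exactly q^2 right factors w of shape e_i and that
   all the products uw exist. By freeness the factors w correspond to the
   extensions of the terminal tile of u by one tile. Such an extension adds two
   triangles one after the other, each with q choices, since an edge lies in
   q + 1 chambers.

   Both that these choices give isometries and that products exist rest on a
   local-to-global principle: a map from a parallelogram to the building that
   sends triangles to chambers and adjacent triangles to distinct chambers is
   isometric. It follows by induction along galleries, using retractions onto
   apartments. To form a product, the missing vertices of the new column are
   filled in one by one: two vertices at distance sqrt 3 have exactly two common
   neighbours. *)
Require Import Defs.
From mathcomp Require Import all_boot all_order all_algebra.
From mathcomp Require Import finmap zify ring.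
From mathcomp Require Import all_classical reals.
Set Implicit Arguments.
Unset Strict Implicit.
Unset Printing Implicit Defensive.
Import Order.TTheory GRing.Theory Num.Theory.
Local Open Scope classical_set_scope.
Local Open Scope card_scope.
Local Open Scope ring_scope.

(** * The triangular lattice *)

(** The axioms put only two simplices at a time into an apartment, so no parallelogram is ever
    placed in one as a whole. The retraction centred at a chamber replaces this: it gives each
    vertex its coordinates in an apartment through that vertex and the chamber. Distances from the
    centre are then exact, and the centre is chosen anew for each first point of a pair.

    The local hypothesis is phrased with vertices alone: squared distance 1 means an edge, and
    squared distance 3 means the apexes of two triangles on a common edge, which must not be
    identified.

    In a new column, squared distance 3 has to be established before common neighbours can be used.
    It comes from types: the neighbours of a vertex in an apartment form a hexagon with two
    alternating types, so distinct neighbours of equal type are neither adjacent nor opposite. *)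

Lemma msdE (x y : lattice) : model_sqdist x y =
  (x.1 - y.1) * (x.1 - y.1) + (x.1 - y.1) * (x.2 - y.2)
  + (x.2 - y.2) * (x.2 - y.2).
Proof. by rewrite /model_sqdist !expr2. Qed.

Lemma msd_sym x y : model_sqdist x y = model_sqdist y x.
Proof. by rewrite !msdE; ring. Qed.

Lemma msd_xx x : model_sqdist x x = 0.
Proof. by rewrite msdE; ring. Qed.

(** Four times the form is [(2 * a + b)^2 + 3 * b^2], and likewise with [a] and [b] exchanged. *)
Lemma eisenstein_le1 (a b : int) : a * a + a * b + b * b <= 1 ->
  [/\ - 1 <= a <= 1, - 1 <= b <= 1 & a * b <= 0].
Proof.
move=> h; have h1 := sqr_ge0 (2 * a + b); have h2 := sqr_ge0 (2 * b + a).
rewrite !expr2 in h1 h2.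
have ha : - 1 <= a <= 1 by nia.
have hb : - 1 <= b <= 1 by nia.
by split=> //; nia.
Qed.

Definition hexagon (x : lattice) : seq lattice :=
  [:: (x.1 + 1, x.2); (x.1, x.2 + 1); (x.1 - 1, x.2 + 1);
      (x.1 - 1, x.2); (x.1, x.2 - 1); (x.1 + 1, x.2 - 1)].

Lemma msd1_hexagon x y : model_sqdist x y = 1 -> y \in hexagon x.
Proof.
case: x y => [a b] [c d]; rewrite msdE /= => h.
have [] : [/\ - 1 <= a - c <= 1, - 1 <= b - d <= 1 & (a - c) * (b - d) <= 0].
  by apply: eisenstein_le1; rewrite h.
move=> /andP[h1 h2] /andP[h3 h4] h5; rewrite /hexagon !inE !xpair_eqE /=.
have [e1|[e1|e1]] : c = a + 1 \/ c = a \/ c = a - 1 by lia.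
all: have [e2|[e2|e2]] : d = b + 1 \/ d = b \/ d = b - 1 by lia.
all: subst c d; lia.
Qed.

Tactic Notation "case_hexagon" hyp(H) :=
  move: (msd1_hexagon H); rewrite /hexagon !inE;
  move=> /or4P[||| /or3P[]] /eqP ?.

Lemma third_vertices x y z w : model_sqdist x y = 1 ->
  model_sqdist x z = 1 -> model_sqdist y z = 1 ->
  model_sqdist x w = 1 -> model_sqdist y w = 1 -> z <> w ->
  model_sqdist z w = 3 /\ forall v,
  model_sqdist x v = 1 -> model_sqdist y v = 1 -> v = z \/ v = w.
Proof.
case: x => a b xy xz yz xw yw zw.
(* The half turn about the midpoint of the edge exchanges its two apexes, so the second one is
   [x + y - v]. *)
suff H v v' : model_sqdist (a, b) v = 1 -> model_sqdist y v = 1 ->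
    model_sqdist (a, b) v' = 1 -> model_sqdist y v' = 1 ->
    v = v' \/ model_sqdist v v' = 3 /\ v' = (a + y.1 - v.1, b + y.2 - v.2).
  case: (H _ _ xz yz xw yw) => // -[-> e]; split=> // v xv yv.
  case: (H _ _ xz yz xv yv); first by left.
  by rewrite -e => -[_]; right.
clear - xy; case_hexagon xy => h1 h2; subst y.
all: case_hexagon h1; subst v; move: h2; rewrite msdE /= => h2.
all: try (exfalso; clear - h2; lia).
all: move=> h3 h4; case_hexagon h3; subst v'; move: h4; rewrite msdE /= => h4.
all: try (exfalso; clear - h4; lia).
all: try (left; congr pair; lia).
all: right; rewrite msdE /=; split; [lia|congr pair; lia].
Qed.

(** [x] and [y] end the long diagonal of a rhombus; [u] and [w = x + y - u] end the short one. *)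
Lemma rhombus x y u : model_sqdist x y = 3 ->
  model_sqdist x u = 1 -> model_sqdist y u = 1 ->
  exists w, [/\ model_sqdist x w = 1, model_sqdist y w = 1,
    model_sqdist u w = 1 &
    forall v, model_sqdist x v = 1 -> model_sqdist y v = 1 -> v = u \/ v = w].
Proof.
case: x => a b xy xu; rewrite msd_sym => uy.
exists (a + y.1 - u.1, b + y.2 - u.2).
case_hexagon xu; subst u; case_hexagon uy; subst y; move: xy;
  rewrite msdE /= => xy;
  try (exfalso; clear - xy; lia).
all: clear; split; try (rewrite msdE /=; lia).
all: move=> v xv yv; case_hexagon xv; subst v; move: yv; rewrite msdE /= => yv;
  try (exfalso; clear - yv; lia).
all: first [left; congr pair; clear; lia | right; congr pair; clear; lia].
Qed.

(* [(i, j, b)] is the triangle cut out by the strips [i <= x.1 <= i + 1],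
   [j <= x.2 <= j + 1] and [k <= x.1 + x.2 <= k + 1] with [k = i + j + b]. *)
Definition cell : Type := (int * int * bool)%type.

Definition corners (c : cell) : seq lattice :=
  let: (i, j, b) := c in
  if b then [:: (i + 1, j); (i, j + 1); (i + 1, j + 1)]
  else [:: (i, j); (i + 1, j); (i, j + 1)].

(* The number of walls separating the two triangles. *)
Definition cell_dist (c c' : cell) : nat :=
  let: (i, j, b) := c in let: (i', j', b') := c' in
  (absz (i - i')%R + absz (j - j')%R +
   absz (i + j + b%:Z - (i' + j' + b'%:Z))%R)%N.

Lemma triangle_cell x y z : model_sqdist x y = 1 ->
  model_sqdist x z = 1 -> model_sqdist y z = 1 ->
  exists c, corners c =i [:: x; y; z].
Proof.
case: x => a b xy xz; rewrite msdE; case_hexagon xy; subst y; case_hexagon xz;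
  subst z; move=> /= h;
 try (exfalso; clear - h; lia).
all: clear h;
 let go c := (exists c; move=> [s t]; rewrite !inE !xpair_eqE /=; clear; lia) in
 first [go (a, b, false) | go (a - 1, b, false) | go (a, b - 1, false)
       | go (a, b - 1, true) | go (a - 1, b, true) | go (a - 1, b - 1, true)].
Qed.

Lemma corners_msd c x y : x \in corners c -> y \in corners c ->
  x = y \/ model_sqdist x y = 1.
Proof.
by case: c => [[i j] []]; rewrite !inE => /or3P[] /eqP-> /or3P[] /eqP->;
 rewrite ?msdE /=; first [by left | right; lia].
Qed.

(** Only the two families of strips that bound parallelograms are constrained, so a gallery obeying
    this stays in every box that contains its ends. *)
Definition between (c0 c c' : cell) : Prop :=
  (Num.min c0.1.1 c.1.1 <= c'.1.1 <= Num.max c0.1.1 c.1.1) &&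
  (Num.min c0.1.2 c.1.2 <= c'.1.2 <= Num.max c0.1.2 c.1.2).

Definition crossing (c c' : cell) (x y o o' : lattice) : Prop :=
  [/\ corners c =i [:: x; y; o], corners c' =i [:: x; y; o'],
      model_sqdist x y = 1, model_sqdist o o' = 3 &
   [/\ model_sqdist x o = 1, model_sqdist y o = 1,
       model_sqdist x o' = 1 & model_sqdist y o' = 1]].

Ltac cross :=
  rewrite /between /cell_dist /crossing /=; split;
  [ | | split; [| | | | split]]; rewrite ?msdE /=;
  try (move=> [s t]; rewrite !inE !xpair_eqE /=); lia.

(** Crossing a side changes one of the three strip coordinates by one. If [c] differs from [c0] and
    neither the first nor the second can be moved towards [c0], the third one can. *)
Lemma closer_cell c0 c : c <> c0 -> exists c' x y o o',
  [/\ cell_dist c0 c = (cell_dist c0 c').+1, between c0 c c' &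
      crossing c c' x y o o'].
Proof.
case: c0 c => [[i0 j0] b0] [[i j] b] /eqP; rewrite !xpair_eqE => ne.
case: b ne => ne.
- have [h|h] := boolP (i < i0).
    exists (i + 1, j, false), (i + 1, j), (i + 1, j + 1), (i, j + 1),
      (i + 2, j); cross.
  have [h'|h'] := boolP (j < j0).
    exists (i, j + 1, false), (i, j + 1), (i + 1, j + 1), (i + 1, j),
      (i, j + 2); cross.
  by exists (i, j, false), (i, j + 1), (i + 1, j), (i + 1, j + 1), (i, j);
    cross.
- have [h|h] := boolP (i0 < i).
    exists (i - 1, j, true), (i, j + 1), (i, j), (i + 1, j),
      (i - 1, j + 1); cross.
  have [h'|h'] := boolP (j0 < j).
    exists (i, j - 1, true), (i + 1, j), (i, j), (i, j + 1),
      (i + 1, j - 1); cross.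
  by exists (i, j, true), (i, j + 1), (i + 1, j), (i, j), (i + 1, j + 1); cross.
Qed.

(** Induction along a shortest gallery from [c0], walked back one triangle at a time from [c]. [D]
    is everything for the plane and a box for a parallelogram. *)
Lemma cell_ind (D : cell -> Prop) (P : cell -> Prop) c0 :
  (forall c c', D c -> between c0 c c' -> D c') ->
  P c0 ->
  (forall c c' x y o o', D c -> D c' -> P c' ->
     cell_dist c0 c = (cell_dist c0 c').+1 -> crossing c c' x y o o' -> P c) ->
  forall c, D c -> P c.
Proof.
move=> hD P0 step c; have [n] := ubnP (cell_dist c0 c).
elim: n c => // n IH c; rewrite ltnS => le Dc.
have [-> //|/eqP ne] := eqVneq c c0.
have [c' [x [y [o [o' [e btw cr]]]]]] := closer_cell ne.
have Dc' := hD _ _ Dc btw.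
by apply: (step _ _ _ _ _ _ Dc Dc' _ e cr); apply: IH => //; rewrite -e.
Qed.

Lemma cell_dist_triangle c1 c2 c3 :
  (cell_dist c1 c3 <= cell_dist c1 c2 + cell_dist c2 c3)%N.
Proof.
by case: c1 c2 c3 => [[? ?] ?] [[? ?] ?] [[? ?] ?]; rewrite /cell_dist; lia.
Qed.

Lemma shared_edge_dist c c' x y : x <> y -> x \in corners c ->
  y \in corners c -> x \in corners c' -> y \in corners c' ->
  (cell_dist c c' <= 1)%N.
Proof.
case: c c' x y => [[i j] b] [[i' j'] b'] [s t] [s' t'] /eqP.
by case: b b' => [] []; rewrite !inE !xpair_eqE /cell_dist /= => *; lia.
Qed.

Lemma corners_inj c c' : corners c =i corners c' -> c = c'.
Proof.
case: c c' => [[i j] b] [[i' j'] b'] h.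
suff : (i, j, b) == (i', j', b') by move/eqP.
rewrite !xpair_eqE.
case: b b' h => [] [] h.
- have h1 := h (i + 1, j); have h2 := h (i, j + 1); have h3 := h (i + 1, j + 1).
  by move: h1 h2 h3; rewrite !inE !xpair_eqE /= !eqxx; lia.
- have h1 := h (i + 1, j); have h2 := h (i, j + 1); have h3 := h (i + 1, j + 1).
  by move: h1 h2 h3; rewrite !inE !xpair_eqE /= !eqxx; lia.
- have h1 := h (i, j); have h2 := h (i + 1, j); have h3 := h (i, j + 1).
  by move: h1 h2 h3; rewrite !inE !xpair_eqE /= !eqxx; lia.
- have h1 := h (i, j); have h2 := h (i + 1, j); have h3 := h (i, j + 1).
  by move: h1 h2 h3; rewrite !inE !xpair_eqE /= !eqxx; lia.
Qed.

Lemma corners_triangle c : exists x y z, [/\ corners c = [:: x; y; z],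
  model_sqdist x y = 1, model_sqdist x z = 1 & model_sqdist y z = 1].
Proof.
case: c => [[i j] []].
  exists (i + 1, j), (i, j + 1), (i + 1, j + 1).
  by rewrite !msdE /=; split=> //; lia.
exists (i, j), (i + 1, j), (i, j + 1).
by rewrite !msdE /=; split=> //; lia.
Qed.

(** Folding along walls is allowed, as it happens when a chart is followed by a retraction;
    injectivity is assumed separately where folding must be excluded. *)
Definition edge_preserving (h : lattice -> lattice) : Prop :=
  forall x y, model_sqdist x y = 1 -> model_sqdist (h x) (h y) = 1.

Lemma edge_preserving_cell h c : edge_preserving h ->
  exists c', corners c' =i map h (corners c).
Proof.
move=> hP; have [x [y [z [-> xy xz yz]]]] := corners_triangle c.
exact: triangle_cell (hP _ _ xy) (hP _ _ xz) (hP _ _ yz).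
Qed.

(** The image of a gallery is a gallery that may stutter, because consecutive image triangles still
    share an edge. *)
Lemma edge_preserving_lipschitz h c c' e e' : edge_preserving h ->
  corners e =i map h (corners c) -> corners e' =i map h (corners c') ->
  (cell_dist e e' <= cell_dist c c')%N.
Proof.
move=> hP ec; move: c' e'.
pose P c' := forall e', corners e' =i map h (corners c') ->
  (cell_dist e e' <= cell_dist c c')%N.
suff H c' : True -> P c' by move=> c' e'; apply: H.
apply: (@cell_ind (fun=> True) P c) => //.
  move=> e' ec'; suff -> : e' = e by rewrite /cell_dist;
    case: (e) => [[? ?] ?]; lia.
  by apply: corners_inj => x; rewrite ec ec'.
move=> {}c' c'' x y o o' _ _ IH dE [c'E c''E xy _ _] e' ec'.
have [e'' ec''] := edge_preserving_cell c'' hP.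
have := IH _ ec''; rewrite dE => le.
have xye := hP _ _ xy.
have mem z : z \in [:: x; y] -> h z \in corners e' /\ h z \in corners e''.
  rewrite !inE => zxy; rewrite ec' ec''.
  by split; apply: map_f; rewrite ?c'E ?c''E !inE orbA zxy.
have [|x1 x2] := mem x; first by rewrite inE eqxx.
have [|y1 y2] := mem y; first by rewrite !inE eqxx orbT.
have ne : h x <> h y by move=> exy; move: xye; rewrite exy msd_xx.
have := shared_edge_dist ne x2 y2 x1 y1.
by have := cell_dist_triangle e e'' e'; lia.
Qed.

Lemma third_eq x y o' z w : model_sqdist x y = 1 ->
  model_sqdist x o' = 1 -> model_sqdist y o' = 1 ->
  model_sqdist x z = 1 -> model_sqdist y z = 1 ->
  model_sqdist x w = 1 -> model_sqdist y w = 1 ->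
  z <> o' -> w <> o' -> z = w.
Proof.
move=> xy xo yo xz yz xw yw zo wo.
by have [_ /(_ w xw yw)[]] := third_vertices xy xz yz xo yo zo.
Qed.

Lemma injective_msd3 (h : lattice -> lattice) o o' : injective h ->
  model_sqdist o o' = 3 -> h o <> h o'.
Proof. by move=> hi d3 /hi e; move: d3; rewrite e msd_xx. Qed.

(** Rigidity: across an edge the next vertex has two possible images, and injectivity rules out the
    one that folds back. *)
Lemma edge_preserving_agree h h' c0 : edge_preserving h ->
  edge_preserving h' -> injective h -> injective h' ->
  {in corners c0, h =1 h'} -> h =1 h'.
Proof.
move=> hP h'P hi h'i e0.
suff H c : True -> {in corners c, h =1 h'}.
  move=> [i j]; apply: (H (i, j, false)) => //.
  by rewrite !inE eqxx.
apply: (@cell_ind (fun=> True) (fun c => {in corners c, h =1 h'}) c0) => //.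
move=> {}c c' x y o o' _ _ IH _ [cE c'E xy oo' [xo yo xo' yo']] z; rewrite cE.
have ex : h x = h' x by apply: IH; rewrite c'E !inE eqxx.
have ey : h y = h' y by apply: IH; rewrite c'E !inE eqxx orbT.
have eo : h o' = h' o' by apply: IH; rewrite c'E !inE eqxx !orbT.
rewrite !inE => /or3P[] /eqP->//.
apply: (@third_eq (h x) (h y) (h o')); try exact: hP.
- by rewrite ex; apply: h'P.
- by rewrite ey; apply: h'P.
- exact: injective_msd3.
- by rewrite eo; apply: injective_msd3.
Qed.

(** * Isometries of the Coxeter complex *)

Definition lattice_isom (h : lattice -> lattice) : Prop :=
  (forall x y, model_sqdist (h x) (h y) = model_sqdist x y) /\
  exists h', cancel h h' /\ cancel h' h.

(** The affine map that takes the base triangle [(0, 0)], [(1, 0)], [(0, 1)] to [t0], [t1], [t2]. *)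
Definition frame_map (t0 t1 t2 x : lattice) : lattice :=
  (t0.1 + x.1 * (t1.1 - t0.1) + x.2 * (t2.1 - t0.1),
   t0.2 + x.1 * (t1.2 - t0.2) + x.2 * (t2.2 - t0.2)).

Lemma frame_map_isom t0 t1 t2 : model_sqdist t0 t1 = 1 ->
  model_sqdist t0 t2 = 1 -> model_sqdist t1 t2 = 1 ->
  lattice_isom (frame_map t0 t1 t2).
Proof.
move=> d1 d2; rewrite msdE; case_hexagon d1; subst t1;
  case_hexagon d2; subst t2; case: t0 d1 d2 => a b _ _ /= d12;
  try (exfalso; clear - d12; lia).
all: clear d12; split; first by move=> [x1 x2] [y1 y2]; rewrite !msdE /=; lia.
(* Cramer's rule, the determinant being its own inverse. *)
all: pose D (p q r s : int) (x : lattice) :=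
  ((p * s - q * r) * (s * (x.1 - a) - r * (x.2 - b)),
   (p * s - q * r) * (p * (x.2 - b) - q * (x.1 - a))) : lattice.
all: let check := (by split; move=> [x1 x2];
       rewrite /D /frame_map /=; congr pair; lia) in
  (* These are the twelve linear isometries of the lattice, a dihedral group. *)
  first
  [exists (D 1 0 0 1); check
  |exists (D 0 1 1 0); check
  |exists (D 1 0 1 (-1)); check
  |exists (D 1 (-1) 1 0); check
  |exists (D 0 1 (-1) 1); check
  |exists (D (-1) 1 0 1); check
  |exists (D (-1) 1 (-1) 0); check
  |exists (D (-1) 0 (-1) 1); check
  |exists (D (-1) 0 0 (-1)); check
  |exists (D 0 (-1) (-1) 0); check
  |exists (D 0 (-1) 1 (-1)); check
  |exists (D 1 (-1) 0 (-1)); check].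
Qed.

Lemma frame_transport a b c a' b' c' : model_sqdist a b = 1 ->
  model_sqdist a c = 1 -> model_sqdist b c = 1 -> model_sqdist a' b' = 1 ->
  model_sqdist a' c' = 1 -> model_sqdist b' c' = 1 ->
  exists2 h, lattice_isom h & [/\ h a = a', h b = b' & h c = c'].
Proof.
move=> ab ac bc ab' ac' bc'.
have [h1i [h1' [h1K h1'K]]] := frame_map_isom ab ac bc.
have [h2i [h2' [h2K h2'K]]] := frame_map_isom ab' ac' bc'.
have frE (t0 t1 t2 : lattice) : [/\ frame_map t0 t1 t2 (0, 0) = t0,
    frame_map t0 t1 t2 (1, 0) = t1 & frame_map t0 t1 t2 (0, 1) = t2].
  case: t0 t1 t2 => [? ?] [? ?] [? ?]; rewrite /frame_map /=.
  by split; congr pair; lia.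
have [e0 e1 e2] := frE a b c; have [e0' e1' e2'] := frE a' b' c'.
exists (frame_map a' b' c' \o h1').
  split=> [x y|]; first by rewrite /= h2i -h1i !h1'K.
  by exists (frame_map a b c \o h2'); split=> x /=;
    rewrite ?h2K ?h1'K ?h1K ?h2'K.
by split=> /=; rewrite -?[in h1' a]e0 -?[in h1' b]e1 -?[in h1' c]e2 h1K.
Qed.

(** By rigidity [h] is the affine map with its values on the base triangle. *)
Lemma edge_preserving_isometry h : edge_preserving h -> injective h ->
  forall x y, model_sqdist (h x) (h y) = model_sqdist x y.
Proof.
move=> hP hi.
have [] := @frame_map_isom (h (0, 0)) (h (1, 0)) (h (0, 1)).
- exact: hP.
- exact: hP.
- exact: hP.
set f := frame_map _ _ _ => fi [f' [fK _]].
suff hf : h =1 f by move=> x y; rewrite !hf fi.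
apply: (@edge_preserving_agree _ _ (0, 0, false)) => //.
- by move=> x y xy; rewrite fi.
- exact: can_inj fK.
move=> x; rewrite !inE => /or3P[] /eqP->; rewrite /f /frame_map /=.
- by rewrite !mul0r !addr0; case: (h _).
- by rewrite !mul0r !mul1r !addr0 !subrKC; case: (h _).
- by rewrite !mul0r !mul1r !addr0 !subrKC; case: (h _).
Qed.

Lemma coxeter_msd s x y : coxeter_complex s -> s x -> s y ->
  x = y \/ model_sqdist x y = 1.
Proof.
move=> [_ [[i j] H]] sx sy.
suff [c [xc yc]] : exists c, x \in corners c /\ y \in corners c.
  exact: corners_msd xc yc.
case: H => H; [exists (i, j, false)|exists (i, j, true)]; rewrite !inE.
  move: (H _ sx) (H _ sy); rewrite /up_triangle /= =>
    -[[->|->]|->] [[->|->]|->];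
  by rewrite !eqxx ?orbT.
move: (H _ sx) (H _ sy); rewrite /down_triangle /= =>
  -[[->|->]|->] [[->|->]|->];
  by rewrite !eqxx ?orbT.
Qed.

Lemma coxeter_triangle s x y z : model_sqdist x y = 1 ->
  model_sqdist x z = 1 -> model_sqdist y z = 1 -> s !=set0 ->
  s `<=` [set x; y; z] -> coxeter_complex s.
Proof.
move=> xy xz yz s0 sxyz; have [[[i j] b] cE] := triangle_cell xy xz yz.
split=> //; exists (i, j).
have H v : s v -> v \in corners (i, j, b).
  move=> /sxyz /= H; rewrite cE !inE; move: H => [[->|->]|->];
  by rewrite eqxx ?orbT.
case: b cE H => _ H; [right|left] => v /H; rewrite !inE /=.
  by case/or3P => /eqP->; rewrite /down_triangle /=; auto.
by case/or3P => /eqP->; rewrite /up_triangle /=; auto.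
Qed.

Lemma coxeter_triangleP s : coxeter_complex s ->
  exists x y z, [/\ model_sqdist x y = 1,
  model_sqdist x z = 1, model_sqdist y z = 1 & s `<=` [set x; y; z]].
Proof.
move=> [_ [[i j] [H|H]]].
  exists (i, j), (i + 1, j), (i, j + 1).
  by rewrite !msdE /=; split=> //; lia.
exists (i + 1, j), (i, j + 1), (i + 1, j + 1).
by rewrite !msdE /=; split=> //; lia.
Qed.

Lemma coxeter_image h s : lattice_isom h -> coxeter_complex s ->
  coxeter_complex (h @` s).
Proof.
move=> [hi _] cs; have [x [y [z [xy xz yz sxyz]]]] := coxeter_triangleP cs.
apply: (@coxeter_triangle _ (h x) (h y) (h z)); rewrite ?hi //.
  by case: cs => [[u su] _]; exists (h u), u.
by move=> _ [u /sxyz [[->|->]|->] <-] /=; auto.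
Qed.

Lemma coxeter_edge x y : model_sqdist x y = 1 -> coxeter_complex [set x; y].
Proof.
move=> xy.
have [z [xz yz]] : exists z, model_sqdist x z = 1 /\ model_sqdist y z = 1.
  case: x xy => a b xy; case_hexagon xy; subst y; clear xy; rewrite /=.
  - by exists (a, b + 1); rewrite !msdE /=; lia.
  - by exists (a + 1, b); rewrite !msdE /=; lia.
  - by exists (a, b + 1); rewrite !msdE /=; lia.
  - by exists (a, b - 1); rewrite !msdE /=; lia.
  - by exists (a - 1, b); rewrite !msdE /=; lia.
  - by exists (a, b - 1); rewrite !msdE /=; lia.
by apply: (@coxeter_triangle _ x y z) => //; exists x; left.
Qed.

Lemma coxeter_point x : coxeter_complex [set x].
Proof.
split; first by exists x.
by exists x; left => _ ->; rewrite /up_triangle /=; auto.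
Qed.

(** * Apartments and retractions *)

Section Charts.
Variable B : building.
Implicit Types (phi psi : lattice -> vertex B) (x y z : vertex B).

Definition chart phi : Prop :=
  exists2 S, apartment S & complex_isom coxeter_complex S phi.

Lemma vertices_coxeter (a : lattice) : a \in vertices coxeter_complex.
Proof. by rewrite in_setE; exists [set a] => //; exact: coxeter_point. Qed.

Lemma chart_inj phi : chart phi -> injective phi.
Proof. by move=> [S _ [inj _]] a b; apply: inj; apply: vertices_coxeter. Qed.

(** In coordinates the isomorphism [f] of the exchange axiom becomes [h = phi'^-1 o f o phi]. Being
    injective and edge preserving is all that rigidity asks of it. *)
Lemma chart_exchange S S' phi phi' (s s' : set (vertex B)) :
  apartment S -> complex_isom coxeter_complex S phi ->
  apartment S' -> complex_isom coxeter_complex S' phi' ->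
  S s -> S s' -> S' s -> S' s' ->
  exists h : lattice -> lattice, [/\ injective h, edge_preserving h &
    forall u, (s `|` s') (phi u) -> phi' (h u) = phi u].
Proof.
move=> aS cS aS' cS' Ss Ss' S's S's'.
have [f [[finj S'E] ffix]] := apartment_exchange aS aS' Ss Ss' S's S's'.
have phiI : injective phi by apply: chart_inj; exists S.
have phi'I : injective phi' by apply: chart_inj; exists S'.
have SE t : coxeter_complex t -> S (phi @` t) by move=> ct; rewrite cS.2;
  exists t.
have fE t : coxeter_complex t ->
    exists2 t', coxeter_complex t' & f @` (phi @` t) = phi' @` t'.
  move=> /SE St; have : S' (f @` (phi @` t)) by rewrite S'E; exists (phi @` t).
  by rewrite cS'.2 => -[t' ct' <-]; exists t'.
have /boolp.choice[h hE] : forall u, exists v, phi' v = f (phi u).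
  move=> u; have [t' _ e] := fE _ (coxeter_point u).
  have : (phi' @` t') (f (phi u)) by rewrite -e; exists (phi u) => //; exists u.
  by move=> [v _ <-]; exists v.
have hinj : injective h.
  move=> u v huv; apply: phiI; apply: finj.
  - by rewrite in_setE; exists [set phi u] => //; rewrite -image_set1;
    apply: SE; exact: coxeter_point.
  - by rewrite in_setE; exists [set phi v] => //; rewrite -image_set1;
    apply: SE; exact: coxeter_point.
  - by rewrite -!hE huv.
exists h; split=> //; last by move=> u su; rewrite hE ffix.
move=> u v uv; have [t' ct' e] := fE _ (coxeter_edge uv).
have ht w : [set u; v] w -> t' (h w).
  move=> uvw; have : (phi' @` t') (f (phi w)).
    by rewrite -e; exists (phi w) => //; exists w.
  by move=> [w' t'w']; rewrite -hE => /phi'I <-.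
have [|//] := coxeter_msd ct' (ht u (or_introl erefl)) (ht v (or_intror erefl)).
by move=> /hinj euv; move: uv; rewrite euv msd_xx.
Qed.

(** The value does not depend on the apartment: two charts that show the same two vertices differ by
    an [h] that is an isometry of the lattice. *)
Lemma sqdist_chart phi a b : chart phi ->
  sqdist (phi a) (phi b) = model_sqdist a b.
Proof.
move=> [S aS cS]; apply: xget_unique; first by exists S, phi, a, b.
move=> _ [S' [phi' [a' [b' [aS' cS' ea eb ->]]]]].
have S1 c : S [set phi c].
  by rewrite cS.2; exists [set c]; rewrite ?image_set1 //; exact: coxeter_point.
have S'1 c : S' [set phi' c].
  by rewrite cS'.2; exists [set c]; rewrite ?image_set1 //;
    exact: coxeter_point.
have [||h [hi hP hfix]] := chart_exchange aS cS aS' cS' (S1 a) (S1 b).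
- by rewrite -ea.
- by rewrite -eb.
have phi'I : injective phi' by apply: chart_inj; exists S'.
have -> : a' = h a by apply: phi'I; rewrite hfix //; left.
have -> : b' = h b by apply: phi'I; rewrite hfix //; right.
exact: edge_preserving_isometry.
Qed.

Lemma chart_cover (s s' : set (vertex B)) : simplex s -> simplex s' ->
  exists phi t t', [/\ chart phi, coxeter_complex t, coxeter_complex t',
    s = phi @` t & s' = phi @` t'].
Proof.
move=> ss ss'; have [S [aS Ss Ss']] := apartment_cover ss ss'.
have [phi cS] := apartment_coxeter aS.
have [t ct tE] : exists2 t, coxeter_complex t & phi @` t = s.
  by move: Ss; rewrite {1}cS.2.
have [t' ct' tE'] : exists2 t', coxeter_complex t' & phi @` t' = s'.
  by move: Ss'; rewrite {1}cS.2.
by exists phi, t, t'; split=> //; exists S.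
Qed.

Lemma chart_simplex phi t : chart phi -> coxeter_complex t ->
  simplex (phi @` t).
Proof.
by move=> [S aS cS] ct; apply: (apartment_sub aS); rewrite cS.2; exists t.
Qed.

Lemma simplex_sqdist (s : set (vertex B)) x y : simplex s -> s x -> s y ->
  x = y \/ sqdist x y = 1.
Proof.
move=> ss; have [phi [t [_ [ch ct _ -> _]]]] := chart_cover ss ss.
move=> [a ta <-] [b tb <-]; rewrite sqdist_chart //.
by have [->|] := coxeter_msd ct ta tb; [left|right].
Qed.

Lemma sqdist_xx x : sqdist x x = 0.
Proof.
have [phi [t [_ [ch ct _ e _]]]] :=
  chart_cover (simplex_vertex x) (simplex_vertex x).
have : (phi @` t) x by rewrite -e.
by move=> [a _ <-]; rewrite sqdist_chart // msd_xx.
Qed.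

Lemma sqdist1_neq x y : sqdist x y = 1 -> x <> y.
Proof. by move=> xy e; move: xy; rewrite e sqdist_xx. Qed.

Lemma sqdist_edge x y : sqdist x y = 1 -> simplex [set x; y].
Proof.
have [phi [t [t' [ch ct ct' e e']]]] :=
  chart_cover (simplex_vertex x) (simplex_vertex y).
have [a _ ea] : (phi @` t) x by rewrite -e.
have [b _ eb] : (phi @` t') y by rewrite -e'.
subst x y; rewrite sqdist_chart // => ab.
suff -> : [set phi a; phi b] = phi @` [set a; b].
  by apply: chart_simplex => //; exact: coxeter_edge.
by rewrite image_setU !image_set1.
Qed.

Lemma sqdist_sym x y : sqdist x y = sqdist y x.
Proof.
have [phi [t [t' [ch ct ct' e e']]]] :=
  chart_cover (simplex_vertex x) (simplex_vertex y).
have [a _ <-] : (phi @` t) x by rewrite -e.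
have [b _ <-] : (phi @` t') y by rewrite -e'.
by rewrite !sqdist_chart // msd_sym.
Qed.

(** Degenerate edges are allowed, so that this also places an edge with a vertex, or two vertices,
    in one apartment. *)
Lemma edges_chart x y z w : x = y \/ sqdist x y = 1 ->
  z = w \/ sqdist z w = 1 -> exists phi a b c d,
  [/\ chart phi, x = phi a, y = phi b, z = phi c & w = phi d].
Proof.
have H (u v : vertex B) : u = v \/ sqdist u v = 1 -> simplex [set u; v].
  by move=> [->|]; [rewrite setUid; apply: simplex_vertex|apply: sqdist_edge].
move=> /H xy /H zw; have [phi [t [t' [ch ct ct' e e']]]] := chart_cover xy zw.
have [a _ ea] : (phi @` t) x by rewrite -e; left.
have [b _ eb] : (phi @` t) y by rewrite -e; right.
have [c _ ec] : (phi @` t') z by rewrite -e'; left.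
have [d _ ed] : (phi @` t') w by rewrite -e'; right.
by exists phi, a, b, c, d.
Qed.

(** The edge [x y] and the vertex [z] lie in one apartment, and in the lattice three mutually
    adjacent points form a triangle. *)
Lemma sqdist_triangle x y z : sqdist x y = 1 -> sqdist x z = 1 ->
  sqdist y z = 1 -> simplex [set x; y; z].
Proof.
move=> xy xz yz; have [||phi [a [b [c [_ [ch ea eb ec _]]]]]] :=
  @edges_chart x y z z.
- by right.
- by left.
subst x y z; rewrite !sqdist_chart // in xy xz yz.
suff -> : [set phi a; phi b; phi c] = phi @` [set a; b; c].
  by apply: chart_simplex => //; apply: (@coxeter_triangle _ a b c) => //;
    exists a; do 2 left.
by rewrite !image_setU !image_set1.
Qed.

Lemma chart_isom phi h : chart phi -> lattice_isom h -> chart (phi \o h).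
Proof.
move=> [S aS [phiI SE]] hi; have [hd [h' [hK h'K]]] := hi; exists S => //;
  split.
  move=> a b _ _ /= e; apply: (can_inj hK).
  by apply: phiI e; apply: vertices_coxeter.
rewrite SE; apply/seteqP; split=> [_ [t ct <-]|_ [t ct <-]].
  exists (h' @` t).
    apply: coxeter_image => //; split; last by exists h.
    by move=> x y; rewrite -hd !h'K.
  by rewrite image_comp; apply: eq_imagel => x _ /=; rewrite h'K.
by exists (h @` t); [apply: coxeter_image|rewrite image_comp].
Qed.

Definition framed (a b c : lattice) x y z phi : Prop :=
  [/\ chart phi, phi a = x, phi b = y & phi c = z].

Section Frame.
Variables (a b c : lattice) (x y z : vertex B).
Hypotheses (ab : model_sqdist a b = 1) (ac : model_sqdist a c = 1).
Hypotheses (bc : model_sqdist b c = 1).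
Hypotheses (xy : sqdist x y = 1) (xz : sqdist x z = 1) (yz : sqdist y z = 1).

Lemma framed_cover (s : set (vertex B)) : simplex s ->
  exists2 phi, framed a b c x y z phi & forall w, s w -> exists u, phi u = w.
Proof.
move=> ss.
have [phi [t [t' [ch ct ct' e e']]]] :=
  chart_cover (sqdist_triangle xy xz yz) ss.
have [a' _ ea] : (phi @` t) x by rewrite -e; do 2 left.
have [b' _ eb] : (phi @` t) y by rewrite -e; left; right.
have [c' _ ec] : (phi @` t) z by rewrite -e; right.
have [|||h hi [ha hb hc]] := @frame_transport a b c a' b' c' ab ac bc.
- by rewrite -(sqdist_chart _ _ ch) ea eb.
- by rewrite -(sqdist_chart _ _ ch) ea ec.
- by rewrite -(sqdist_chart _ _ ch) eb ec.
exists (phi \o h).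
  by split; rewrite /= ?ha ?hb ?hc //; apply: chart_isom.
move=> w; rewrite e' => -[u _ <-]; have [_ [h' [_ h'K]]] := hi.
by exists (h' u) => /=; rewrite h'K.
Qed.

(** The exchange map between the two charts fixes the chamber pointwise, so by rigidity it is the
    identity. A vertex therefore has the same coordinates in all normalised charts that contain
    it. *)
Lemma framed_inj phi phi' u u' : framed a b c x y z phi ->
  framed a b c x y z phi' -> phi u = phi' u' -> u = u'.
Proof.
move=> [[S aS cS] ea eb ec] [[S' aS' cS'] ea' eb' ec'] e.
have SE t : coxeter_complex t -> S (phi @` t).
  by move=> ct; rewrite cS.2; exists t.
have SE' t : coxeter_complex t -> S' (phi' @` t).
  by move=> ct; rewrite cS'.2; exists t.
have ct : coxeter_complex [set a; b; c].
  by apply: (@coxeter_triangle _ a b c) => //; exists a; do 2 left.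
have [||h [hi hP hfix]] :=
  chart_exchange aS cS aS' cS' (SE _ ct) (SE _ (coxeter_point u)).
- rewrite (_ : _ @` _ = phi' @` [set a; b; c]); first exact: SE'.
  by rewrite !image_setU !image_set1 ea eb ec ea' eb' ec'.
- by rewrite image_set1 e -image_set1; apply: SE'; apply: coxeter_point.
have phi'I : injective phi' by apply: chart_inj; exists S'.
have ha : h a = a.
  by apply: phi'I; rewrite hfix ?ea ?ea' //; left; exists a => //; do 2 left.
have hb : h b = b.
  by apply: phi'I; rewrite hfix ?eb ?eb' //; left; exists b => //; left; right.
have hc : h c = c.
  by apply: phi'I; rewrite hfix ?ec ?ec' //; left; exists c => //; right.
have [c0 c0E] := triangle_cell ab ac bc.
have -> : u = h u.
  apply: (@edge_preserving_agree id h c0) => // v.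
  by rewrite c0E !inE => /or3P[] /eqP->.
by apply: phi'I; rewrite hfix //; right; exists u.
Qed.

(** The coordinate in any normalised chart is well defined by [framed_inj]. Edges survive because an
    edge and the chamber lie in a common apartment. *)
Lemma retraction : exists rho : vertex B -> lattice,
  (forall phi u, framed a b c x y z phi -> rho (phi u) = u) /\
  (forall v w, sqdist v w = 1 -> model_sqdist (rho v) (rho w) = 1).
Proof.
have /boolp.choice[rho rhoP] : forall v, exists u,
    exists2 phi, framed a b c x y z phi & phi u = v.
  move=> v; have [phi fr /(_ v erefl)[u uv]] := framed_cover (simplex_vertex v).
  by exists u, phi.
have rhoK phi u : framed a b c x y z phi -> rho (phi u) = u.
  by move=> fr; have [phi' fr' e] := rhoP (phi u); apply: framed_inj e.
exists rho; split=> // v w vw.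
have [phi fr cov] := framed_cover (sqdist_edge vw).
have [u uv] : exists u, phi u = v by apply: cov; left.
have [u' uw] : exists u, phi u = w by apply: cov; right.
by rewrite -uv -uw !rhoK // -(@sqdist_chart phi) ?uv ?uw //; case: fr.
Qed.

End Frame.

End Charts.

(** * Local isometries of parallelograms *)

Section LocalToGlobal.
Variable B : building.
Implicit Types (D : lattice -> Prop) (f : lattice -> vertex B).

Definition isom_on D f : Prop := forall a b, D a -> D b ->
  sqdist (f a) (f b) = model_sqdist a b.

Definition local_isom_on D f : Prop := forall a b, D a -> D b ->
  (model_sqdist a b = 1 -> sqdist (f a) (f b) = 1) /\
  (model_sqdist a b = 3 -> f a <> f b).

Definition box (M N : nat) (a : lattice) : Prop :=
  (0 <= a.1 <= M%:Z) && (0 <= a.2 <= N%:Z).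

(** These cells fill [box M.+1 N.+1]; a box with a side of length zero contains no cell, hence the
    successors below. *)
Definition box_cell (M N : nat) (c : cell) : Prop :=
  (0 <= c.1.1 <= M%:Z) && (0 <= c.1.2 <= N%:Z).

Lemma box_corners M N c a : box_cell M N c -> a \in corners c ->
  box M.+1 N.+1 a.
Proof.
case: c => [[i j] b]; rewrite /box_cell /box /= => h.
by case: b; rewrite !inE => /or3P[] /eqP-> /=; lia.
Qed.

Lemma box_has_cell M N a : box M.+1 N.+1 a ->
  exists2 c, box_cell M N c & a \in corners c.
Proof.
case: a => i j; rewrite /box /box_cell /= => h.
have [hi|hi] := boolP (i <= M%:Z); have [hj|hj] := boolP (j <= N%:Z).
- by exists (i, j, false); rewrite ?inE ?eqxx //=; lia.
- by exists (i, j - 1, false); rewrite ?inE ?xpair_eqE /=; lia.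
- by exists (i - 1, j, false); rewrite ?inE ?xpair_eqE /=; lia.
- by exists (i - 1, j - 1, true); rewrite ?inE ?xpair_eqE /=; lia.
Qed.

Lemma box_cell_between M N c0 : box_cell M N c0 ->
  forall c c', box_cell M N c -> between c0 c c' -> box_cell M N c'.
Proof.
case: c0 => [[? ?] ?] h0 [[? ?] ?] [[? ?] ?]; move: h0.
by rewrite /box_cell /between /=; lia.
Qed.

(* If the retraction centred at [f c0] folded [f c] onto [f c'], then the
   retraction centred at [f c] would map a gallery from [c0] to [c'] to a
     gallery
   from [c0] to [c], although [c] is farther from [c0] than [c']. *)
Lemma retraction_step f (rho : vertex B -> lattice) c0 c c' a0 b0 d0 x y o o' :
  corners c0 = [:: a0; b0; d0] ->
  model_sqdist a0 b0 = 1 -> model_sqdist a0 d0 = 1 -> model_sqdist b0 d0 = 1 ->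
  sqdist (f a0) (f b0) = 1 -> sqdist (f a0) (f d0) = 1 ->
  sqdist (f b0) (f d0) = 1 ->
  (forall phi u, framed a0 b0 d0 (f a0) (f b0) (f d0) phi -> rho (phi u) = u) ->
  (forall v w, sqdist v w = 1 -> model_sqdist (rho v) (rho w) = 1) ->
  crossing c c' x y o o' -> cell_dist c0 c = (cell_dist c0 c').+1 ->
  sqdist (f x) (f y) = 1 -> sqdist (f x) (f o) = 1 -> sqdist (f y) (f o) = 1 ->
  sqdist (f x) (f o') = 1 -> sqdist (f y) (f o') = 1 -> f o <> f o' ->
  rho (f x) = x -> rho (f y) = y -> rho (f o') = o' -> rho (f o) = o.
Proof.
move=> c0E ab0 ad0 bd0 fab0 fad0 fbd0 rhoK rhoP.
move=> [cE c'E xy oo' [xo yo xo' yo']] dist fxy fxo fyo fxo' fyo' foo' rx ry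
  ro'.
have noo' : o <> o' by move=> e; move: oo'; rewrite e msd_xx.
have third := (third_vertices xy xo yo xo' yo' noo').2.
(* [rho (f o)] is an apex over the edge [x y]; suppose it is [o']. *)
have := third (rho (f o)).
rewrite -{1}rx -{1}ry !rhoP // => -[] // ro; exfalso.
have frK phi w : framed a0 b0 d0 (f a0) (f b0) (f d0) phi ->
    (exists u, phi u = w) -> phi (rho w) = w.
  by move=> fr [u <-]; rewrite (rhoK _ _ fr).
(* [phi] and [phi'] chart apartments through the image of [c0] and, respectively, the images of [c]
   and [c']. By assumption [phi] shows the image of [c] in the place of [c']. *)
have [phi fr cov] := framed_cover ab0 ad0 bd0 fab0 fad0 fbd0
  (sqdist_triangle fxy fxo fyo).
have phix : phi x = f x by rewrite -{1}rx; apply: frK (cov _ _) => //;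
  do 2 left.
have phiy : phi y = f y by rewrite -{1}ry; apply: frK (cov _ _) => //; left;
  right.
have phio' : phi o' = f o by rewrite -{1}ro; apply: frK (cov _ _) => //; right.
have [phi' fr' cov'] := framed_cover ab0 ad0 bd0 fab0 fad0 fbd0
  (sqdist_triangle fxy fxo' fyo').
have phi'x : phi' x = f x by rewrite -{1}rx; apply: frK (cov' _ _) => //;
  do 2 left.
have phi'y : phi' y = f y by rewrite -{1}ry; apply: frK (cov' _ _) => //; left;
  right.
have phi'o' : phi' o' = f o' by rewrite -{1}ro'; apply: frK (cov' _ _) => //;
  right.
(* This retraction is centred at the image of [c], put in the place of [c'] to agree with [phi]. *)
have [rho2 [rho2K rho2P]] := retraction xy xo' yo' fxy fxo fyo.
have fr2 : framed x y o' (f x) (f y) (f o) phi by split=> //; case: fr.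
have [ch' a'E b'E d'E] := fr'; have [ch aE bE dE] := fr.
have hP : edge_preserving (rho2 \o phi').
  by move=> u v uv /=; apply: rho2P; rewrite sqdist_chart.
(* [phi] and [phi'] agree on [c0], and [rho2] inverts [phi]. *)
have h0 u : u \in corners c0 -> rho2 (phi' u) = u.
  rewrite c0E !inE => /or3P[] /eqP->; first by rewrite a'E -aE rho2K.
    by rewrite b'E -bE rho2K.
  by rewrite d'E -dE rho2K.
have hx : rho2 (f x) = x by rewrite -phix rho2K.
have hy : rho2 (f y) = y by rewrite -phiy rho2K.
have ho' : rho2 (f o') = o.
  (* The value [o'] would give [f o'] and [f o] the same place in one apartment. *)
  have := third (rho2 (f o')).
  rewrite -{1}hx -{1}hy !rho2P // => -[] // e; exfalso.
  have [psi [psich psix psiy psio'] pcov] :=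
    framed_cover xy xo' yo' fxy fxo fyo (simplex_vertex (f o')).
  have [u pu] := pcov _ erefl.
  have : u = o' by rewrite -e -pu rho2K.
  by move=> eu; apply: foo'; rewrite -pu eu psio'.
have : (cell_dist c0 c <= cell_dist c0 c')%N.
  apply: edge_preserving_lipschitz hP _ _.
    by move=> u; rewrite c0E /= !h0 ?c0E // !inE ?eqxx ?orbT.
  have e : corners c' =i [:: x; y; o'] by [].
  move=> u; rewrite (eq_mem_map _ e) /= phi'x phi'y phi'o' hx hy ho'.
  exact: cE.
by rewrite dist ltnn.
Qed.

(** With the centre at a triangle containing [a], the induction shows that [rho o f] is the identity
    on the box. An apartment through the centre and [f b] then has [f b] at the place [b], and so
    shows the distance from [f a] to [f b]. *)
Lemma local_isom_on_box M N f :
  local_isom_on (box M.+1 N.+1) f -> isom_on (box M.+1 N.+1) f.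
Proof.
move=> loc a b /box_has_cell[c0 c0in ac0] /box_has_cell[c1 c1in bc1].
have [a0 [b0 [d0 [c0E ab0 ad0 bd0]]]] := corners_triangle c0.
have c0box u : u \in [:: a0; b0; d0] -> box M.+1 N.+1 u.
  by rewrite -c0E; apply: box_corners.
have boxa : box M.+1 N.+1 a0 by apply: c0box; rewrite inE eqxx.
have boxb : box M.+1 N.+1 b0 by apply: c0box; rewrite !inE eqxx orbT.
have boxd : box M.+1 N.+1 d0 by apply: c0box; rewrite !inE eqxx !orbT.
have fab0 := (loc _ _ boxa boxb).1 ab0.
have fad0 := (loc _ _ boxa boxd).1 ad0.
have fbd0 := (loc _ _ boxb boxd).1 bd0.
have [rho [rhoK rhoP]] := retraction ab0 ad0 bd0 fab0 fad0 fbd0.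
pose P c := forall u, u \in corners c -> rho (f u) = u.
have : P c1.
  apply: (@cell_ind (box_cell M N) P c0) c1in => //;
    first exact: box_cell_between.
    have [phi fr _] := framed_cover ab0 ad0 bd0 fab0 fad0 fbd0 (simplex_vertex
      (f a0)).
    have [ch aE bE dE] := fr.
    move=> u; rewrite c0E !inE => /or3P[] /eqP->; first by rewrite -aE rhoK.
      by rewrite -bE rhoK.
    by rewrite -dE rhoK.
  move=> c c' x y o o' cin c'in Pc' dist cr.
  have [cE c'E xy oo' [xo yo xo' yo']] := cr.
  have c'box u : u \in [:: x; y; o'] -> box M.+1 N.+1 u /\ rho (f u) = u.
    by rewrite -c'E => uc'; split; [apply: box_corners uc'|apply: Pc'].
  have [boxx rx] : box M.+1 N.+1 x /\ rho (f x) = x by apply: c'box;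
    rewrite inE eqxx.
  have [boxy ry] : box M.+1 N.+1 y /\ rho (f y) = y.
    by apply: c'box; rewrite !inE eqxx orbT.
  have [boxo' ro'] : box M.+1 N.+1 o' /\ rho (f o') = o'.
    by apply: c'box; rewrite !inE eqxx !orbT.
  have boxo : box M.+1 N.+1 o.
    by apply: box_corners cin _; rewrite cE !inE eqxx !orbT.
  move=> u; rewrite cE !inE => /or3P[] /eqP-> //.
  apply: (retraction_step c0E ab0 ad0 bd0 fab0 fad0 fbd0 rhoK rhoP cr dist) =>
    //.
  - exact: (loc _ _ _ _).1.
  - exact: (loc _ _ _ _).1.
  - exact: (loc _ _ _ _).1.
  - exact: (loc _ _ _ _).1.
  - exact: (loc _ _ _ _).1.
  - exact: (loc _ _ _ _).2.
move=> /(_ _ bc1) rb.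
have [phi fr cov] := framed_cover ab0 ad0 bd0 fab0 fad0 fbd0 (simplex_vertex (f
  b)).
have [ch aE bE dE] := fr.
have [u pu] := cov _ erefl.
have ub : u = b by rewrite -rb -pu rhoK.
have pa : phi a = f a by move: ac0; rewrite c0E !inE => /or3P[] /eqP->.
by rewrite -pu -pa sqdist_chart // ub.
Qed.

End LocalToGlobal.

(** * Common neighbours *)

(** On the hexagon around [a], distinct [b] and [d] are adjacent, two steps apart, or opposite; in
    the last case [w1] and [w2] fill one of the arcs between them. *)
Lemma hexagon_dist (a b d : lattice) : model_sqdist a b = 1 ->
  model_sqdist a d = 1 -> b <> d ->
  [\/ model_sqdist b d = 1, model_sqdist b d = 3 | exists w1 w2,
    [/\ model_sqdist a w1 = 1, model_sqdist b w1 = 1, model_sqdist a w2 = 1,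
        model_sqdist w1 w2 = 1 & model_sqdist w2 d = 1]].
Proof.
case: a => i j ab ad bd; case_hexagon ab; subst b; case_hexagon ad; subst d;
  rewrite /= in bd *; try (by case: bd); clear.
all: first [by apply: Or31; rewrite msdE /=; lia
           |by apply: Or32; rewrite msdE /=; lia|apply: Or33].
- by exists (i, j + 1), (i - 1, j + 1); rewrite !msdE /=; split; lia.
- by exists (i - 1, j + 1), (i - 1, j); rewrite !msdE /=; split; lia.
- by exists (i - 1, j), (i, j - 1); rewrite !msdE /=; split; lia.
- by exists (i, j - 1), (i + 1, j - 1); rewrite !msdE /=; split; lia.
- by exists (i + 1, j - 1), (i + 1, j); rewrite !msdE /=; split; lia.
- by exists (i + 1, j), (i, j + 1); rewrite !msdE /=; split; lia.
Qed.

Section CommonNeighbours.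
Variable B : building.
Implicit Types (x y z u v w : vertex B).

Definition common_neighbour x y w : Prop := sqdist x w = 1 /\ sqdist y w = 1.

(** In an apartment through the triangle [x y z] and [w], the vertices [z] and [w] would be the two
    apexes over [x y], which are at squared distance 3. *)
Lemma no_tetrahedron x y z w : sqdist x y = 1 -> common_neighbour x y z ->
  common_neighbour x y w -> sqdist z w <> 1.
Proof.
move=> xy [xz yz] [xw yw] zw.
have [phi [t [t' [ch ct _ e e']]]] :=
  chart_cover (sqdist_triangle xy xz yz) (simplex_vertex w).
have [a _ ea] : (phi @` t) x by rewrite -e; do 2 left.
have [b _ eb] : (phi @` t) y by rewrite -e; left; right.
have [c _ ec] : (phi @` t) z by rewrite -e; right.
have [d _ ed] : (phi @` t') w by rewrite -e'.
subst x y z w; rewrite !sqdist_chart // in xy xz yz xw yw zw.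
have cd : c <> d by move=> cd; move: zw; rewrite cd msd_xx.
by have [] := third_vertices xy xz yz xw yw cd; rewrite zw.
Qed.

(** The two edges [x u] and [y w] bring all four vertices into one apartment, where they form a
    rhombus. *)
Lemma common_neighbour_adjacent x y u w : sqdist x y = 3 ->
  common_neighbour x y u -> common_neighbour x y w -> u <> w -> sqdist u w = 1.
Proof.
move=> xy [xu yu] [xw yw] uw.
have [phi [a [b [c [d [ch ea eb ec ed]]]]]] :=
  edges_chart (or_intror xu) (or_intror yw).
subst x u y w; rewrite !sqdist_chart // in xy xu yu xw yw *.
have [w [aw cw bw H]] := rhombus xy xu yu.
by have [edb|->//] := H _ xw yw; case: uw; rewrite edb.
Qed.

(** Three common neighbours would be mutually adjacent and form a tetrahedron with [x]. *)
Lemma common_neighbour_two x y u v w : sqdist x y = 3 ->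
  common_neighbour x y u -> common_neighbour x y v -> u <> v ->
  common_neighbour x y w -> w = u \/ w = v.
Proof.
move=> xy cu cv uv cw.
have [->|/eqP wu] := eqVneq w u; first by left.
have [->|/eqP wv] := eqVneq w v; first by right.
have uv1 := common_neighbour_adjacent xy cu cv uv.
have uw1 : sqdist u w = 1 by apply: common_neighbour_adjacent xy cu cw _ =>
  /esym.
have vw1 : sqdist v w = 1 by apply: common_neighbour_adjacent xy cv cw _ =>
  /esym.
exfalso; apply: (@no_tetrahedron u v w x uv1) => //; last first.
  by rewrite sqdist_sym; case: cw.
by split; rewrite sqdist_sym; [case: cu|case: cv].
Qed.

Lemma other_common_neighbour x y u : sqdist x y = 3 ->
  common_neighbour x y u -> exists2 w, common_neighbour x y w & sqdist u w = 1.
Proof.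
move=> xy [xu yu].
have [phi [a [b [c [d [ch ea eb ec ed]]]]]] :=
  edges_chart (or_intror xu) (or_introl (erefl y)).
move: ea eb ec xy xu yu => -> -> ->; rewrite !sqdist_chart // => xy xu yu.
have [w [aw cw bw _]] := rhombus xy xu yu.
by exists (phi w); rewrite /common_neighbour ?sqdist_chart.
Qed.

Lemma vtype_adjacent x y : sqdist x y = 1 -> vtype x <> vtype y.
Proof.
move=> xy e; apply: (sqdist1_neq xy); apply: vtype_inj e.
- exact: (sqdist_edge xy).
- by rewrite in_setE; left.
- by rewrite in_setE; right.
Qed.

Lemma Z3_third (a b c d : 'Z_3) : a <> b -> c <> a -> c <> b -> d <> a ->
  d <> b -> c = d.
Proof.
move=> /eqP ab /eqP ca /eqP cb /eqP da /eqP db; apply/eqP.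
by move: a b c d ab ca cb da db;
  do 4 case=> [[|[|[|//]]] ?].
Qed.

Lemma vtype_opposite x y u v : sqdist x y = 1 -> common_neighbour x y u ->
  common_neighbour x y v -> vtype u = vtype v.
Proof.
move=> xy [xu yu] [xv yv].
by apply: (@Z3_third (vtype x) (vtype y)); try exact: vtype_adjacent;
  apply/nesym; apply: vtype_adjacent.
Qed.

Lemma sqdist3_same_type v x y : sqdist v x = 1 -> sqdist v y = 1 -> x <> y ->
  vtype x = vtype y -> sqdist x y = 3.
Proof.
move=> vx vy xy txy.
have [phi [a [b [c [d [ch ea eb ec ed]]]]]] :=
  edges_chart (or_intror vx) (or_intror vy).
have eac : a = c by apply: (chart_inj ch); rewrite -ea -ec.
subst c v x y; rewrite !sqdist_chart // in vx vy *.
have bd : b <> d by move=> e; apply: xy; rewrite e.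
have [bd1||[w1 [w2 [aw1 bw1 aw2 w12 w2d]]]] := hexagon_dist vx vy bd => //.
  by case: (@vtype_adjacent (phi b) (phi d)); rewrite ?sqdist_chart.
(* The opposite case: [w2] has the type of [x], both being apexes over the edge from [v] to [w1],
   yet it is adjacent to [y]. *)
case: (@vtype_adjacent (phi w2) (phi d)); rewrite ?sqdist_chart // -txy.
apply: (@vtype_opposite (phi a) (phi w1));
  rewrite /common_neighbour !sqdist_chart //.
by rewrite (msd_sym w1 b).
Qed.

End CommonNeighbours.

(** * Extending a parallelogram by a column *)

Section Extension.
Variable B : building.
Implicit Types (f r : lattice -> vertex B).

Lemma isom_on_swap M N f : isom_on (box M N) f ->
  isom_on (box N M) (fun a => f (a.2, a.1)).
Proof.
move=> fi [a1 a2] [b1 b2] /andP[/= ha1 ha2] /andP[/= hb1 hb2].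
by rewrite fi /box /= ?ha1 ?ha2 ?hb1 ?hb2 // !msdE /=; ring.
Qed.

Lemma isom_on_local D f : isom_on D f -> local_isom_on D f.
Proof.
move=> fi a b Da Db; rewrite fi //; split=> // ab e.
by have := fi _ _ Da Db; rewrite e sqdist_xx ab.
Qed.

(** Over a common edge the two apexes have equal types, in the building and in the model, so types
    propagate along galleries. *)
Lemma isom_on_vtype M N f c0 k : isom_on (box M.+1 N.+1) f -> box_cell M N c0 ->
  (forall a, a \in corners c0 -> vtype (f a) = model_type a + k) ->
  forall a, box M.+1 N.+1 a -> vtype (f a) = model_type a + k.
Proof.
move=> fi c0in H0 a /box_has_cell[c cin]; move: a.
pose P c := forall a, a \in corners c -> vtype (f a) = model_type a + k.
have mtE (a b : lattice) : model_type a = model_type b <->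
  (a.1 - a.2 - b.1 + b.2)%:~R = 0 :> 'Z_3.
  rewrite /model_type !(rmorphD, rmorphN) /=; split => [|/eqP h].
    by move=> e; rewrite e; ring.
  by apply/eqP; rewrite -subr_eq0; move: h; congr (_ == _); ring.
apply: (@cell_ind (box_cell M N) P c0) c cin => //;
  first exact: box_cell_between.
move=> c c' x y o o' cin c'in Pc' _ [cE c'E xy oo' [xo yo xo' yo']].
have bx a : a \in [:: x; y; o; o'] -> box M.+1 N.+1 a.
  rewrite !inE => h; have [ac|ac'] : a \in corners c \/ a \in corners c'.
  - by rewrite cE c'E !inE; case/or4P: h => ->; rewrite ?orbT; auto.
  - exact: box_corners cin ac.
  - exact: box_corners c'in ac'.
have [bxx bxy bxo bxo'] :
  [/\ box M.+1 N.+1 x, box M.+1 N.+1 y, box M.+1 N.+1 o &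
  box M.+1 N.+1 o'] by split; apply: bx; rewrite !inE eqxx ?orbT.
move=> a; rewrite cE !inE => /or3P[] /eqP->.
- by apply: Pc'; rewrite c'E !inE eqxx.
- by apply: Pc'; rewrite c'E !inE eqxx orbT.
rewrite (@vtype_opposite _ (f x) (f y) (f o) (f o')) ?fi //; first last.
- by split; rewrite fi.
- by split; rewrite fi.
rewrite Pc' ?c'E ?inE ?eqxx ?orbT //; congr (_ + _); apply/mtE.
clear - xy xo yo xo' yo' oo'.
case: x xy xo xo' => i j xy xo xo'; case_hexagon xy; subst y; case_hexagon xo;
  subst o;
  move: yo; rewrite msdE /= => yo; try (exfalso; clear - yo; lia).
all: clear yo; case_hexagon xo'; subst o'; move: yo' oo';
  rewrite !msdE /= => h1 h2;
  try (exfalso; clear - h1; lia); try (exfalso; clear - h2; lia).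
all: clear.
(* From one apex to the other, the difference of the two coordinates changes by a multiple of 3. *)
all: rewrite /=; match goal with |- ?z%:~R = _ =>
   first [have -> : z = 0 by ring | have -> : z = 3 by ring | have -> :
     z = - 3 by ring] end.
all: exact: val_inj.
Qed.

Section Column.
Variables (M N : nat) (f r : lattice -> vertex B).
Hypothesis fi : isom_on (box M.+1 N.+1) f.
Hypothesis ri : isom_on (box 2 1) r.
Hypothesis glue : forall a, box 1 1 a -> f (M%:Z + a.1, N%:Z + a.2) = r a.

(** [X] and [Z] are the last two columns of the box, indexed downwards: the new tile sits in the
    upper right corner, and the new column grows down from it. *)
Let X (k : nat) := f (M%:Z + 1, N%:Z + 1 - k%:Z).
Let Z (k : nat) := f (M%:Z, N%:Z + 1 - k%:Z).

Ltac box_dist H :=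
  rewrite ?/X ?/Z H; [rewrite msdE /=; lia|rewrite /box /=; lia..].

(* [y'] and [y] are the vertices at heights [N + 1 - k] and [N - k] of the
   column to the right of the box. *)
Let column_step (k : nat) (y' y : vertex B) : Prop :=
  [/\ sqdist y y' = 1, sqdist (X k.+1) y = 1, sqdist (X k) y = 1,
      y <> Z k & X k.+1 <> y'].

Lemma column_step0 : column_step 0 (r (2, 1)) (r (2, 0)).
Proof.
have X1 : X 1 = r (1, 0) by rewrite -glue // /X /=; congr f; congr pair; lia.
have X0 : X 0 = r (1, 1) by rewrite -glue // /X /=; congr f; congr pair; lia.
have Z0 : Z 0 = r (0, 1) by rewrite -glue // /Z /=; congr f; congr pair; lia.
split; rewrite ?X1 ?X0 ?Z0 ?ri //.
  by apply: (isom_on_local ri _ _).2.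
by apply: (isom_on_local ri _ _).2.
Qed.

(** The next vertex is the second common neighbour of [X k.+2] and [y], the first being [X k.+1]. *)
Lemma column_stepS k y' y : (k < N)%N -> column_step k y' y ->
  exists w, column_step k.+1 y w.
Proof.
move=> kN [yy' Xy X'y yZ _].
have XX : sqdist (X k.+2) (X k.+1) = 1 by box_dist fi.
have neq : X k.+2 <> y.
  move=> e; have : sqdist (X k.+2) (X k) = 4 by box_dist fi.
  by rewrite e sqdist_sym X'y.
(* Both vertices are apexes opposite to [Z k], over the edges from [X k.+1] to [Z k.+1] and to
   [X k]. *)
have ty : vtype (X k.+2) = vtype y.
  transitivity (vtype (Z k)).
    apply: (@vtype_opposite _ (X k.+1) (Z k.+1)); first by box_dist fi.
      by split; box_dist fi.
    by split; box_dist fi.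
  apply: (@vtype_opposite _ (X k.+1) (X k)); first by box_dist fi.
    by split; box_dist fi.
  by split.
have XX' : sqdist (X k.+1) (X k.+2) = 1 by rewrite sqdist_sym.
have d3 := sqdist3_same_type XX' Xy neq ty.
have cX : common_neighbour (X k.+2) y (X k.+1) by split=> //;
  rewrite sqdist_sym.
have [w [Xw yw] Xkw] := other_common_neighbour d3 cX.
exists w; split=> //=; first by rewrite sqdist_sym.
(* If [w] were [Z k.+1], then [X k.+1], [Z k] and [y] would be three distinct common neighbours of
   [Z k.+1] and [X k]. *)
move=> wZ; have ZX3 : sqdist (Z k.+1) (X k) = 3 by box_dist fi.
have c1 : common_neighbour (Z k.+1) (X k) (X k.+1) by split; box_dist fi.
have c2 : common_neighbour (Z k.+1) (X k) (Z k) by split; box_dist fi.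
have c3 : common_neighbour (Z k.+1) (X k) y by split=> //;
  rewrite -wZ sqdist_sym.
have XZ : X k.+1 <> Z k by apply: sqdist1_neq; box_dist fi.
have [e|//] := common_neighbour_two ZX3 c1 c2 XZ c3.
by move: Xy; rewrite e sqdist_xx.
Qed.

Lemma column_exists : exists Y : nat -> vertex B,
  [/\ Y 0%N = r (2, 1), Y 1%N = r (2, 0) &
      forall k, (k < N.+1)%N -> column_step k (Y k) (Y k.+1)].
Proof.
have /boolp.choice[s sP] : forall p : nat * vertex B * vertex B, exists w,
    (p.1.1 < N)%N -> column_step p.1.1 p.1.2 p.2 ->
    column_step p.1.1.+1 p.2 w.
  move=> [[k y'] y] /=.
  have [[kN st]|h] := pselect ((k < N)%N /\ column_step k y' y).
    by have [w] := column_stepS kN st; exists w.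
  by exists y => kN st; case: h.
pose YY k := iteri k (fun k p => (p.2, s (k, p.1, p.2))) (r (2, 1), r (2, 0)).
exists (fun k => (YY k).1); split=> // k.
elim: k => [|k IH] kN; first exact: column_step0.
by apply: (sP (k, (YY k).1, (YY k).2)) => //=; apply: IH; exact: ltnW.
Qed.

(** By [local_isom_on_box] only pairs at squared distance 1 or 3 are to be checked, and such a pair
    of a new and an old vertex involves only the old columns [X] and [Z]. *)
Lemma extend_right : exists f' : lattice -> vertex B,
  [/\ isom_on (box M.+2 N.+1) f', forall a, box M.+1 N.+1 a -> f' a = f a &
      forall a, box 2 1 a -> f' (M%:Z + a.1, N%:Z + a.2) = r a].
Proof.
have [Y [Y0 Y1 YP]] := column_exists.
pose f' (a : lattice) := if a.1 == M%:Z + 2 then Y (absz (N%:Z + 1 - a.2)%R)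
  else f a.
have f'new j : f' (M%:Z + 2, j) = Y (absz (N%:Z + 1 - j)%R) by rewrite /f' eqxx.
have f'old a : box M.+1 N.+1 a -> f' a = f a.
  by rewrite /f' /box => ha; case: eqP => // e; exfalso; lia.
exists f'; split=> //.
  apply: local_isom_on_box.
  pose L a b := (model_sqdist a b = 1 -> sqdist (f' a) (f' b) = 1) /\
     (model_sqdist a b = 3 -> f' a <> f' b).
  have Lsym a b : L a b -> L b a.
    by rewrite /L (msd_sym b a) (sqdist_sym (f' b)) => -[h1 h2];
      split=> // /h2 + e; apply.
  have boxP a : box M.+2 N.+1 a -> box M.+1 N.+1 a \/ exists2 k :
    nat, (k <= N.+1)%N &
      a = (M%:Z + 2, N%:Z + 1 - k%:Z).
    case: a => i j; rewrite /box /= => h; have [e|ne] := eqVneq i (M%:Z + 2).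
      right; exists (absz (N%:Z + 1 - j)%R); first by lia.
      by congr pair; lia.
    by left; lia.
  have f'Y k : (k <= N.+1)%N -> f' (M%:Z + 2, N%:Z + 1 - k%:Z) = Y k.
    by move=> kN; rewrite f'new; congr Y; lia.
  have YX k : (k <= N.+1)%N -> sqdist (X k) (Y k) = 1.
    case: k => [_|k kN]; last by case: (YP k kN).
    have -> : X 0 = r (1, 1) by rewrite -glue // /X /=; congr f; congr pair;
      lia.
    by rewrite Y0 ri.
  have Lno k i j : (k <= N.+1)%N -> box M.+1 N.+1 (i, j) ->
    L (M%:Z + 2, N%:Z + 1 - k%:Z) (i, j).
    move=> kN ij; rewrite /L f'Y // f'old //.
    have [ei|ni] := eqVneq i (M%:Z + 1).
      subst i; rewrite msdE /=; split=> h.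
        have [e|e] : j = N%:Z + 1 - k%:Z \/ j = N%:Z + 1 - k%:Z + 1.
          by have := eisenstein_le1 (a := 1) (b := N%:Z + 1 - k%:Z - j); nia.
          by rewrite e sqdist_sym; apply: YX.
        case: k kN h e => [|k] kN h e; first by move: ij; rewrite /box /=; lia.
        have -> : f (M%:Z + 1, j) = X k by rewrite /X; congr f; congr pair; lia.
        by rewrite sqdist_sym; case: (YP k kN).
      have [e|e] : j = N%:Z + 1 - k%:Z - 1 \/ j = N%:Z + 1 - k%:Z + 2.
        by nia.
        have kN' : (k < N.+1)%N by move: ij; rewrite /box /=; lia.
        have -> : f (M%:Z + 1, j) = X k.+1 by rewrite /X; congr f; congr pair;
          lia.
        by case: (YP k kN') => _ _ _ _ /nesym.
      (* [column_step] does not record this pair: identifying its members would put [X k] next to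
         [X k.+2], which is at squared distance 4. *)
      case: k kN h e => [|[|k]] kN h e; try by move: ij; rewrite /box /=; lia.
      have -> : f (M%:Z + 1, j) = X k by rewrite /X; congr f; congr pair; lia.
      move=> eY; have := YX _ kN; rewrite eY.
      have -> : sqdist (X k.+2) (X k) = 4 by box_dist fi.
      by [].
    have iM : i < M%:Z + 1 by move: ij; rewrite /box /=; lia.
    rewrite msdE /=; split=> h.
      exfalso; have := @eisenstein_le1 (M%:Z + 2 - i) (N%:Z + 1 - k%:Z - j).
      by rewrite h => -[//|]; lia.
    have [ei ej] : i = M%:Z /\ j = N%:Z + 1 - k%:Z + 1.
      move: h; move eu : (M%:Z + 2 - i) => u;
        move ev : (N%:Z + 1 - k%:Z - j) => v h.
      have h2 := sqr_ge0 (2 * v + u); rewrite expr2 in h2.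
      have u2' : 2 <= u by lia.
      have u2 : u = 2 by clear - h h2 u2'; nia.
      have v1 : v = -1 by clear - h u2; subst u; nia.
      by split; lia.
    case: k kN h ej => [|k] kN h ej; first by move: ij; rewrite /box /=; lia.
    have -> : f (i, j) = Z k by rewrite /Z ei; congr f; congr pair; lia.
    by case: (YP k kN).
  move=> a b /boxP[oa|[k kN ->]] /boxP[ob|[l lN ->]].
  - by rewrite !f'old //; apply: (isom_on_local fi).
  - by case: a oa => i j oa; apply: Lsym; apply: Lno.
  - by case: b ob => i j ob; apply: Lno.
  (* Within the new column squared distances are perfect squares, so 3 does not occur. *)
  - rewrite !f'Y // msdE /= (_ : _ + _ = (l%:Z - k%:Z) * (l%:Z - k%:Z));
      last by ring.
    move ed : (l%:Z - k%:Z) => d; split=> h; last first.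
      have hd : [|| d <= -2, -1 <= d <= 1 | 2 <= d] by lia.
      by exfalso; case/or3P: hd => hd; nia.
    have d1 : d = 1 \/ d = -1 by nia.
    have [e|e] : k = l.+1 \/ l = k.+1 by lia.
      by subst k; case: (YP l kN).
    by subst l; rewrite sqdist_sym; case: (YP k lN).
move=> [i j] /=; rewrite /box /= => ij.
have [e|ne] := eqVneq i 2; last first.
  rewrite -glue; last by rewrite /box /=; lia.
  by apply: f'old; rewrite /box /=; lia.
rewrite e f'new.
have [ej|ej] : j = 0 \/ j = 1 by lia.
  by rewrite ej -Y1; congr Y; lia.
by rewrite ej -Y0; congr Y; lia.
Qed.

End Column.

End Extension.

(** * Counting the extensions of a tile *)

Lemma card_eq_seq (T : choiceType) (s : seq T) : uniq s ->
  [set x | x \in s] #= `I_(size s).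
Proof.
move=> us; rewrite (_ : [set _ | _] = [set` [fset x in s]%fset]).
  by apply/card_eq_fsetP; rewrite card_fseq undup_id.
by apply/seteqP; split=> x /=; rewrite !inE.
Qed.

Lemma extend_up (B : building) M N (f r : lattice -> vertex B) :
  isom_on (box M.+1 N.+1) f -> isom_on (box 1 2) r ->
  (forall a, box 1 1 a -> f (M%:Z + a.1, N%:Z + a.2) = r a) ->
  exists f' : lattice -> vertex B,
  [/\ isom_on (box M.+1 N.+2) f', forall a, box M.+1 N.+1 a -> f' a = f a &
      forall a, box 1 2 a -> f' (M%:Z + a.1, N%:Z + a.2) = r a].
Proof.
have boxC m n (i j : int) : box m n (i, j) -> box n m (j, i).
  by rewrite /box /= andbC.
move=> /isom_on_swap fi /isom_on_swap ri glue.
have [|f' [f'i f'f f'r]] := extend_right fi ri.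
  by move=> [i j] /boxC ij /=; rewrite (glue (j, i)).
exists (fun a => f' (a.2, a.1)); split; first exact: isom_on_swap.
  by move=> [i j] /boxC /f'f.
by move=> [i j] /boxC /f'r.
Qed.

Section Count.
Variable B : building.
Implicit Types (x y z u : vertex B) (t : lattice -> vertex B).

Lemma chamber_third x y : sqdist x y = 1 ->
  [set c : set (vertex B) | chamber c /\ [set x; y] `<=` c] =
  (fun z => [set x; y; z]) @` [set z | common_neighbour x y z].
Proof.
move=> xy; apply/seteqP; split=> [c [[sc c3] xyc]|_ [z [xz yz] <-]]; last first.
  split; last by move=> w; left.
  split; first exact: sqdist_triangle.
  rewrite (_ : [set _; _; _] = [set w | w \in [:: x; y; z]]).
    apply: (@card_eq_seq _ [:: x; y; z]).
    rewrite /= !inE !negb_or !andbT.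
    by apply/andP; split; [apply/andP; split|]; apply/eqP; exact: sqdist1_neq.
  apply/seteqP; split=> w /=; rewrite !inE.
    by move=> [[->|->]|->]; rewrite eqxx ?orbT.
  by move=> /or3P[] /eqP->; auto.
have cx : c x by apply: xyc; left.
have cy : c y by apply: xyc; right.
have nxy := sqdist1_neq xy.
have [z cz [zx zy]] : exists2 z, c z & z <> x /\ z <> y.
  apply: contrapT => H; suff cE : c = [set w | w \in [:: x; y]].
    have : `I_3 #= `I_2.
      apply: card_eq_trans (card_esym c3) _; rewrite cE.
      apply: (@card_eq_seq _ [:: x; y]).
      by rewrite /= !inE andbT; apply/eqP.
    by move/card_eq_II.
  apply/seteqP; split=> w /=; rewrite !inE; last by case/orP => /eqP->.
  by move=> cw; apply: contrapT => /negP/norP[wx wy]; apply: H; exists w => //;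
    split; apply/eqP.
have adj v w : c v -> c w -> v <> w -> sqdist v w = 1.
  by move=> cv cw vw; case: (simplex_sqdist sc cv cw).
have xz : sqdist x z = 1 by apply: adj => // /esym.
have yz : sqdist y z = 1 by apply: adj => // /esym.
exists z; first by split.
apply/seteqP; split=> [w [[->|->]|->] //|w cw].
have [->|/eqP wx] := eqVneq w x; first by do 2 left.
have [->|/eqP wy] := eqVneq w y; first by left; right.
have [->|/eqP wz] := eqVneq w z; first by right.
exfalso; apply: (@no_tetrahedron _ x y z w xy); first by split.
  by split; apply: adj => // /esym.
by apply: adj => // /esym.
Qed.

Lemma other_thirds q x y u : of_order B q -> sqdist x y = 1 ->
  common_neighbour x y u -> exists s : seq (vertex B),
  [/\ uniq s, size s = q & forall z, z \in s <-> common_neighbour x y z /\ z <>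
    u].
Proof.
move=> Bq xy cu.
have e2 : edge [set x; y].
  split; first exact: sqdist_edge.
  rewrite (_ : [set _; _] = [set w | w \in [:: x; y]]).
    apply: (@card_eq_seq _ [:: x; y]).
    by rewrite /= !inE andbT; apply/eqP; exact: sqdist1_neq.
  apply/seteqP; split=> w /=; rewrite !inE.
    by move=> [->|->]; rewrite eqxx ?orbT.
  by move=> /orP[] /eqP->; auto.
have := Bq _ e2; rewrite chamber_third // => cardI.
have cardC : [set z | common_neighbour x y z] #= `I_q.+1.
  apply: card_eq_trans cardI; apply: card_esym; apply: inj_card_eq.
  move=> z w; rewrite !in_setE /= => -[xz yz] [xw yw] e.
  have : [set x; y; w] z by rewrite -e; right.
  by move=> [[ez|ez]|//]; [case: (sqdist1_neq xz)|case: (sqdist1_neq yz)].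
have finC : finite_set [set z | common_neighbour x y z] by exists q.+1.
have memC z : (z \in fset_set [set z |
  common_neighbour x y z]) = `[< common_neighbour x y z >].
  by rewrite in_fset_set //; apply/idP/asboolP; rewrite in_setE.
exists (rem u (fset_set [set z | common_neighbour x y z])); split.
- exact: rem_uniq.
- rewrite size_rem ?memC; last by apply/asboolP.
  by have := card_fset_set cardC; rewrite cardfE /= -cardfE => ->.
- move=> z; rewrite mem_rem_uniq // inE /= memC.
  by split=> [/andP[/eqP zu /asboolP cz]|[cz /eqP zu]]; last (rewrite zu;
    apply/asboolP).
Qed.

(** [p.1] and [p.2] stand at [(2, 0)] and [(2, 1)], completing a second tile to the right of [t].
    The two inequalities keep each new triangle from folding onto the one before. *)
Definition good_pair t (p : vertex B * vertex B) : Prop :=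
  (common_neighbour (t (1, 0)) (t (1, 1)) p.1 /\ p.1 <> t (0, 1)) /\
  (common_neighbour (t (1, 1)) p.1 p.2 /\ p.2 <> t (1, 0)).

Lemma good_pairs q t : of_order B q -> isom_on (box 1 1) t ->
  exists s : seq (vertex B * vertex B),
  [/\ uniq s, size s = (q * q)%N & forall p, p \in s <-> good_pair t p].
Proof.
move=> Bq ti.
have d1 : sqdist (t (1, 0)) (t (1, 1)) = 1 by rewrite ti.
have [s [us ss sP]] := other_thirds Bq d1 (u := t (0, 1))
  (conj (ti (1, 0) (0, 1) erefl erefl) (ti (1, 1) (0, 1) erefl erefl)).
have /boolp.choice[s2 s2P] : forall y, exists s2 : seq (vertex B),
    y \in s -> [/\ uniq s2, size s2 = q &
    forall z, z \in s2 <-> common_neighbour (t (1, 1)) y z /\ z <> t (1, 0)].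
  move=> y; have [ys|nys] := boolP (y \in s); last by exists [::].
  have [[d2 d3] _] := (sP y).1 ys.
  have [|s2 ?] := other_thirds Bq d3 (u := t (1, 0)); last by exists s2.
  by split; rewrite ?ti // sqdist_sym.
exists [seq (y, z) | y <- s, z <- s2 y]; split.
- apply: allpairs_uniq_dep => //; first by move=> y /s2P[].
  by move=> [a b] [c d] _ _ /= [-> ->].
- rewrite size_allpairs_dep (_ : [seq _ | _ <- _] = nseq q q) ?sumn_nseq //.
  rewrite -{1}ss -(size_map (fun y => size (s2 y)) s); apply/all_pred1P.
  by apply/allP => _ /mapP[y /s2P[_ ? _] ->]; apply/eqP.
- move=> [y z]; rewrite /good_pair /=; split.
    move=> /allpairsPdep[y' [z' [ys zs [-> ->]]]].
    by have [_ _ /(_ z')[h _]] := s2P _ ys; split; [apply/sP|apply: h].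
  move=> [hy hz]; apply/allpairsPdep; exists y, z.
  have ys : y \in s by apply/sP.
  by split=> //; have [_ _ ->] := s2P _ ys.
Qed.

End Count.

(** * Strips of two tiles, and automorphisms as isometries *)

Section Strip.
Variable B : building.
Implicit Types (f : lattice -> vertex B).

Lemma box21 (a : lattice) : box 2 1 a ->
  [\/ box 1 1 a, a = (2, 0) | a = (2, 1)].
Proof.
case: a => i j; rewrite /box /= => h.
have [[ei [ej|ej]]|hi] : (i = 2 /\ (j = 0 \/ j = 1)) \/ i <= 1 by lia.
- by apply: Or32; rewrite ei ej.
- by apply: Or33; rewrite ei ej.
- by apply: Or31; lia.
Qed.

Lemma box11 (a : lattice) : box 1 1 a -> a \in [:: (0, 0); (0, 1); (1, 0);
  (1, 1)].
Proof.
by case: a => i j; rewrite /box /= !inE !xpair_eqE; lia.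
Qed.

(** The conditions in [good_pair] cover exactly the pairs at squared distance 1 or 3 in the strip
    that involve a new vertex. *)
Lemma good_pairP f : isom_on (box 1 1) f ->
  good_pair f (f (2, 0), f (2, 1)) <-> isom_on (box 2 1) f.
Proof.
move=> ti; split=> [[[[d1 d2] n1] [[d3 d4] n2]]|fi]; last first.
  by split; (split; [split; rewrite fi|apply: (isom_on_local fi _ _).2]).
apply: (@local_isom_on_box _ 1 0) => a b.
pose L a b := (model_sqdist a b = 1 -> sqdist (f a) (f b) = 1) /\
     (model_sqdist a b = 3 -> f a <> f b).
have Lsym c d : L c d -> L d c.
  by rewrite /L (msd_sym d c) (sqdist_sym (f d)) => -[h1 h2];
    split=> // /h2 + e; apply.
have Lxx c : L c c by split; rewrite msd_xx.
have L20 c : box 1 1 c -> L c (2, 0).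
  by move/box11; rewrite !inE => /or4P[] /eqP->; split=> // _; apply/nesym.
have L21 c : box 1 1 c -> L c (2, 1).
  by move/box11; rewrite !inE => /or4P[] /eqP->; split=> // _; apply/nesym.
have L22 : L (2, 0) (2, 1) by split.
move=> /box21[ha|->|->] /box21[hb|->|->];
  do ?[exact: L20|exact: L21|exact: L22|exact: Lxx].
- exact: (isom_on_local ti).
- by apply: Lsym; apply: L20.
- by apply: Lsym; apply: L21.
- by apply: Lsym.
Qed.

(** The apartment system need not be stable under [g], so the image of an apartment cannot be used
    directly. Instead [g] after a chart is locally isometric on a box containing both points. *)
Lemma simplicial_isom (g : vertex B -> vertex B) x y : injective g ->
  (forall s, simplex s -> simplex (g @` s)) -> sqdist (g x) (g y) = sqdist x y.
Proof.
move=> gi gs.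
have [phi [a [_ [b [_ [ch -> _ -> _]]]]]] :=
  edges_chart (or_introl (erefl x)) (or_introl (erefl y)).
(* Boxes start at the origin, so the two points are translated to nonnegative coordinates. *)
pose tr (c d : lattice) : lattice := (d.1 + c.1, d.2 + c.2).
pose m := (Num.min a.1 b.1, Num.min a.2 b.2).
have tri c : lattice_isom (tr c).
  split; first by move=> u v; rewrite !msdE /=; ring.
  by exists (tr (- c.1, - c.2)); split=> -[u v]; rewrite /tr /=; congr pair;
    ring.
have ch' := chart_isom ch (tri m).
pose a' := tr (- m.1, - m.2) a; pose b' := tr (- m.1, - m.2) b.
have aE : tr m a' = a.
  by rewrite /tr /a' /=; case: (a) => ? ?; congr pair; rewrite /=; ring.
have bE : tr m b' = b.
  by rewrite /tr /b' /=; case: (b) => ? ?; congr pair; rewrite /=; ring.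
rewrite sqdist_chart // -aE -bE -(sqdist_chart _ _ ch) (sqdist_chart a' b' ch').
pose M := absz (Num.max a'.1 b'.1); pose N := absz (Num.max a'.2 b'.2).
apply: (@local_isom_on_box _ M N (g \o phi \o tr m)).
- move=> u v _ _; rewrite -(sqdist_chart _ _ ch') /=; split=> uv; last first.
    by move=> /gi e; move: uv; rewrite e sqdist_xx.
  have := gs _ (sqdist_edge uv); rewrite image_setU !image_set1 => s1.
  have [e|//] := simplex_sqdist s1 (or_introl erefl) (or_intror erefl).
  by case: (sqdist1_neq uv); apply: gi.
- by rewrite /box /M /N /a' /b' /tr /m /=; lia.
- by rewrite /box /M /N /a' /b' /tr /m /=; lia.
Qed.

(** An apartment already shows two triangles on each edge. *)
Lemma building_order_gt0 q : of_order B q -> (0 < q)%N.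
Proof.
move=> Bq; have [S aS] := apartment_nonempty B.
have [phi cS] := apartment_coxeter aS.
have ch : chart phi by exists S.
have d01 : sqdist (phi (0, 0)) (phi (1, 0)) = 1 by rewrite sqdist_chart.
have cu : common_neighbour (phi (0, 0)) (phi (1, 0)) (phi (0, 1)).
  by split; rewrite sqdist_chart.
have [s [_ <- /(_ (phi (1, -1)))[_ H]]] := other_thirds Bq d01 cu.
have : phi (1, -1) \in s.
  by apply: H; split; [split; rewrite sqdist_chart|move/(chart_inj ch)].
by case: (s).
Qed.

End Strip.

(** * Parallelograms as maps on lattice boxes, and the number of extensions of a tile *)

Section Parallelograms.
Variable B : building.

Lemma pt_box m (l : pvertex m) : box m.1.+1 m.2.+1 (pt l).
Proof.
by case: l => [[i hi] [j hj]]; rewrite /box /pt /= !lez_nat -ltnS hi -ltnS hj.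
Qed.

Lemma box_pt m (a : lattice) : box m.1.+1 m.2.+1 a -> exists l :
  pvertex m, pt l = a.
Proof.
case: a => i j; rewrite /box /= => h.
have hi : (absz i < m.1.+2)%N by lia.
have hj : (absz j < m.2.+2)%N by lia.
exists (Ordinal hi, Ordinal hj); rewrite /pt /=; congr pair; lia.
Qed.

(** Meaningful only on the box of [m]; elsewhere [absz] and [inord] produce arbitrary values. *)
Definition lift_map m (p : {ffun pvertex m -> vertex B}) (a : lattice) :
  vertex B :=
  p (inord (absz a.1), inord (absz a.2)).

Lemma lift_map_pt m (p : {ffun pvertex m -> vertex B}) l :
  lift_map p (pt l) = p l.
Proof. by case: l => i j; rewrite /lift_map /= !inord_val. Qed.

Lemma isometric_lift m (p : {ffun pvertex m -> vertex B}) :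
  isometric p <-> isom_on (box m.1.+1 m.2.+1) (lift_map p).
Proof.
split=> [pi a b /box_pt[l <-] /box_pt[l' <-]|pi l l'];
  first by rewrite !lift_map_pt.
by rewrite -(lift_map_pt p l) -(lift_map_pt p l') pi //; apply: pt_box.
Qed.

Lemma pt_pshift m k s (l : pvertex k) :
  (s.1 + k.1 <= m.1)%N -> (s.2 + k.2 <= m.2)%N ->
  pt (pshift m s l) = (s.1%:Z + (pt l).1, s.2%:Z + (pt l).2).
Proof.
move=> h1 h2; case: l => [[i hi] [j hj]].
by rewrite /pt /pshift /= !inordK ?PoszD //; lia.
Qed.

Lemma windowE m k s (p : {ffun pvertex m -> vertex B}) (l : pvertex k) :
  (s.1 + k.1 <= m.1)%N -> (s.2 + k.2 <= m.2)%N ->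
  window k s p l = lift_map p (s.1%:Z + (pt l).1, s.2%:Z + (pt l).2).
Proof. by move=> h1 h2; rewrite ffunE -(pt_pshift l h1 h2) lift_map_pt. Qed.

Definition restrict_map m (f : lattice -> vertex B) : {ffun pvertex m ->
  vertex B} :=
  [ffun l => f (pt l)].

Lemma lift_restrict m f a : box m.1.+1 m.2.+1 a ->
  lift_map (restrict_map m f) a = f a.
Proof. by move=> /box_pt[l <-]; rewrite lift_map_pt ffunE. Qed.

Lemma restrict_isometry m f c : isom_on (box m.1.+1 m.2.+1) f ->
  (forall a, box 1 1 a -> vtype (f a) = model_type a + c) ->
  @isometries B m (restrict_map m f).
Proof.
move=> fi ft; split.
  exists c => l; rewrite ffunE;
    apply: (@isom_on_vtype B m.1 m.2 f (0, 0, false)).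
  - exact: fi.
  - by rewrite /box_cell /=.
  - by move=> a; rewrite !inE => /or3P[] /eqP->; apply: ft.
  - exact: pt_box.
by move=> l l'; rewrite !ffunE fi //; apply: pt_box.
Qed.

Lemma isometries_vtype m (p : {ffun pvertex m -> vertex B}) :
  @isometries B m p ->
  exists c, forall a, box m.1.+1 m.2.+1 a ->
    vtype (lift_map p a) = model_type a + c.
Proof.
by move=> [[c pc] _]; exists c => a /box_pt[l <-]; rewrite lift_map_pt.
Qed.

Lemma box_le M N M' N' a : (M <= M')%N -> (N <= N')%N -> box M N a ->
  box M' N' a.
Proof. by rewrite /box => *; lia. Qed.

(** Turns extensions in the second direction into extensions in the first, so that strips are
    counted only once. *)
Definition swap_axes (i : 'I_2) (a : lattice) : lattice :=
  if i == ord0 then a else (a.2, a.1).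

Lemma swap_axesK i : involutive (swap_axes i).
Proof. by case=> a b; rewrite /swap_axes; case: (i == ord0). Qed.

Lemma swap_axes_msd i a b :
  model_sqdist (swap_axes i a) (swap_axes i b) = model_sqdist a b.
Proof. by rewrite /swap_axes; case: ifP => // _; rewrite !msdE /=; ring. Qed.

Lemma box_swap_axes i a :
  box (e_ i).1.+1 (e_ i).2.+1 (swap_axes i a) = box 2 1 a.
Proof.
by rewrite /swap_axes /e_; case: ifP => // _; rewrite /box /= andbC.
Qed.

Lemma box11_swap_axes i a : box 1 1 (swap_axes i a) = box 1 1 a.
Proof. by rewrite /swap_axes; case: ifP => // _; rewrite /box /= andbC. Qed.

Lemma isom_on_swap_axes i (f : lattice -> vertex B) :
  isom_on (box (e_ i).1.+1 (e_ i).2.+1) f <->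
  isom_on (box 2 1) (f \o swap_axes i).
Proof.
split=> fi a b ha hb.
  by rewrite /= fi ?box_swap_axes // swap_axes_msd.
rewrite -[a](swap_axesK i) -[b](swap_axesK i) in ha hb *.
by rewrite !box_swap_axes in ha hb; rewrite swap_axes_msd -fi.
Qed.

Section Extensions.
Variables (i : 'I_2) (T : @isometries B shape0).

Let t := lift_map (val T) \o swap_axes i.

Definition tile_extensions : set (@isometries B (e_ i)) :=
  [set r | initial_tile r = T].

Definition new_vertices (r : @isometries B (e_ i)) : vertex B * vertex B :=
  (lift_map (val r) (swap_axes i (2, 0)),
   lift_map (val r) (swap_axes i (2, 1))).

Let isomP m (r : @isometries B m) : @isometries B m (val r).
Proof. exact: (set_mem (valP r)). Qed.

Lemma initial_tile_lift m (r : @isometries B m) a : box 1 1 a ->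
  lift_map (val (initial_tile r)) a = lift_map (val r) a.
Proof.
by move=> /(@box_pt shape0)[l <-]; rewrite lift_map_pt windowE // !add0r.
Qed.

Lemma extension_tile r : tile_extensions r ->
  forall a, box 1 1 a -> lift_map (val r) (swap_axes i a) = t a.
Proof.
by move=> rT a ha; rewrite /t /= -rT initial_tile_lift // box11_swap_axes.
Qed.

Lemma tile_isom : isom_on (box 1 1) t.
Proof.
have [_ /isometric_lift Ti] := isomP T.
by move=> a b ha hb; rewrite /t /= Ti ?box11_swap_axes // swap_axes_msd.
Qed.

Lemma new_vertices_image : new_vertices @` tile_extensions = [set p |
  good_pair t p].
Proof.
apply/seteqP; split=> [_ [r rT <-]|[y z] gp] /=.
  have [_ /isometric_lift/isom_on_swap_axes ri] := isomP r.
  have tE := extension_tile rT.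
  rewrite /good_pair -!tE //;
    apply/(good_pairP (f := lift_map (val r) \o swap_axes i)) => //.
  by move=> a b ha hb; apply: ri; apply: box_le _ _ ha || apply: box_le _ _ hb.
pose f (a : lattice) := if a == (2, 0) then y else if a == (2, 1) then z else t
  a.
have fE a : box 1 1 a -> f a = t a.
  by move=> /box11; rewrite !inE => /or4P[] /eqP->.
have fi : isom_on (box 2 1) f.
  apply/good_pairP => //.
  by move=> a b ha hb; rewrite !fE //; apply: tile_isom.
have fi' : isom_on (box (e_ i).1.+1 (e_ i).2.+1) (f \o swap_axes i).
  apply/isom_on_swap_axes; rewrite -compA (_ : swap_axes i \o _ = id) //.
  by apply/funext => a /=; rewrite swap_axesK.
have [c Tc] := isometries_vtype (isomP T).
have ri : @isometries B (e_ i) (restrict_map (e_ i) (f \o swap_axes i)).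
  apply: (restrict_isometry (c := c)) => // a ha.
  by rewrite /= fE ?box11_swap_axes // /t /= swap_axesK Tc.
pose r : @isometries B (e_ i) :=
    exist (fun p => p \in @isometries B (e_ i)) _ (mem_set ri).
exists r.
  apply: val_inj; apply/ffunP => l; rewrite windowE // -lift_map_pt !add0r.
  rewrite (_ : (_, _) = pt l); last by case: (pt l).
  have bl : box 1 1 (pt l) := pt_box l.
  rewrite lift_restrict; last by apply: box_le _ _ bl.
  by rewrite /= fE ?box11_swap_axes // /t /= swap_axesK.
rewrite /new_vertices !lift_restrict ?box_swap_axes //=.
by rewrite !swap_axesK /f.
Qed.

Lemma new_vertices_inj : {in tile_extensions &, injective new_vertices}.
Proof.
move=> r r'; rewrite !in_setE => rT rT' [e0 e1].
apply: val_inj; apply/ffunP => l; rewrite -!lift_map_pt.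
have := pt_box l; rewrite -[pt l](swap_axesK i) box_swap_axes.
by move=> /box21[h|->|->] //; rewrite !extension_tile.
Qed.

Lemma card_tile_extensions q : of_order B q -> tile_extensions #= `I_(q * q).
Proof.
move=> Bq; have [s [us ss sP]] := good_pairs Bq tile_isom.
apply: card_eq_trans (card_esym (inj_card_eq new_vertices_inj)) _.
rewrite new_vertices_image (_ : [set _ | _] = [set p | p \in s]).
  by rewrite -ss; apply: card_eq_seq.
by apply/seteqP; split=> p /= /sP.
Qed.

End Extensions.

End Parallelograms.

(** * Words *)

Section Words.
Variables (B : building) (G : rotation_group B).

Lemma word_classP m (p p' : @isometries B m) :
  word_class G p = word_class G p' <->
  exists2 g, gset G g & forall l, val p' l = g (val p l).
Proof.
split=> [/eqmodP/asboolP//|H].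
by apply/eqmodP/asboolP.
Qed.

Lemma word_reprK m (u : words_of G m) : word_class G (word_repr u) = u.
Proof. exact: reprK. Qed.

Lemma rotation_sqdist g x y : gset G g -> sqdist (g x) (g y) = sqdist x y.
Proof.
move=> Gg; have [h _ [gK _]] := gset_inv Gg.
have [[_ sE] _] := gset_auto Gg.
apply: simplicial_isom; first exact: can_inj gK.
by move=> s ss; rewrite sE; exists s.
Qed.

Lemma rotation_isometries g m (p : {ffun pvertex m -> vertex B}) : gset G g ->
  @isometries B m p -> @isometries B m [ffun l => g (p l)].
Proof.
move=> Gg [[c pc] pi]; have [_ [c' gc']] := gset_auto Gg; split.
  by exists (c + c') => l; rewrite ffunE gc' pc addrA.
by move=> l l'; rewrite !ffunE rotation_sqdist.
Qed.

Lemma word_class_initial m (p p' : @isometries B m) :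
  word_class G p = word_class G p' ->
  word_class G (initial_tile p) = word_class G (initial_tile p').
Proof.
move=> /word_classP[g Gg e]; apply/word_classP; exists g => // l.
by rewrite !ffunE.
Qed.

Lemma word_o_class m (p : @isometries B m) :
  word_o (Tagged (words_of G) (word_class G p)) = word_class G (initial_tile p).
Proof. by apply: word_class_initial; rewrite word_reprK. Qed.

Lemma initial_tile_id (p : @isometries B shape0) : initial_tile p = p.
Proof.
apply: val_inj; apply/ffunP => l; rewrite windowE // !add0r.
by rewrite -surjective_pairing lift_map_pt.
Qed.

Definition extension_word i (r : @isometries B (e_ i)) : word G :=
  Tagged (words_of G) (word_class G r).

(** A word that starts with the letter of [T] has a representative that starts with [T] itself: move
    any representative by a suitable group element. *)
Lemma extension_word_image i (T : @isometries B shape0) :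
  @extension_word i @` tile_extensions T =
  [set w | sigma w = e_ i /\ word_o w = word_class G T].
Proof.
apply/seteqP; split=> [_ [r rT <-]|[m c] /= [em]] /=.
  by split=> //; rewrite word_o_class rT.
subst m; rewrite -[c]word_reprK word_o_class; set r := word_repr c.
move=> /word_classP[g Gg e].
have gr := rotation_isometries Gg (set_mem (valP r)).
pose r' : @isometries B (e_ i) :=
  exist (fun p => p \in @isometries B (e_ i)) _ (mem_set gr).
exists r'; first by apply: val_inj; apply/ffunP => l; rewrite e !ffunE.
have rr' : word_class G r = word_class G r'.
  by apply/word_classP; exists g => // l; rewrite ffunE.
by rewrite /extension_word -rr'.
Qed.

(** A group element carrying one extension of [T] to another fixes the vertices of [T], so by
    freeness it is the identity. *)
Lemma extension_word_inj i (T : @isometries B shape0) : acts_freely G ->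
  {in tile_extensions T &, injective (@extension_word i)}.
Proof.
move=> Gfree r r'; rewrite !in_setE => rT r'T /eqP.
rewrite eq_Tagged => /eqP /word_classP[g Gg e].
suff gid : g = id by apply: val_inj; apply/ffunP => l; rewrite e gid.
pose l0 : pvertex shape0 := (ord0, ord0).
have eT x : tile_extensions T x -> val x (pshift (e_ i) shape0 l0) = val T l0.
  by move=> <-; rewrite ffunE.
by apply: (Gfree g (val T l0)) => //; rewrite -{1}(eT _ rT) -e eT.
Qed.

Lemma card_right_factors q i (T : @isometries B shape0) : of_order B q ->
  acts_freely G ->
  [set w : word G | sigma w = e_ i /\ word_o w = word_class G T] #= `I_(q * q).
Proof.
move=> Bq Gfree; rewrite -extension_word_image.
apply: card_eq_trans (inj_card_eq (extension_word_inj Gfree)) _.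
exact: card_tile_extensions.
Qed.

Lemma product_exists m i (p : @isometries B m) (r : @isometries B (e_ i)) :
  initial_tile r = terminal_tile p ->
  exists p' : @isometries B (shapeD m (e_ i)),
    val p = window m shape0 (val p') /\ val r = window (e_ i) m (val p').
Proof.
move=> glue.
have [pt /isometric_lift pi] := set_mem (valP p).
have [rt /isometric_lift ri] := set_mem (valP r).
pose f := lift_map (val p); pose h := lift_map (val r).
have fh a : box 1 1 a -> f (m.1%:Z + a.1, m.2%:Z + a.2) = h a.
  move=> ha; rewrite /h -initial_tile_lift // glue.
  move: ha => /(@box_pt shape0)[l <-]; rewrite lift_map_pt windowE //= addn0 //.
have [f' [f'i f'f f'h]] : exists f' : lattice -> vertex B,
  [/\ isom_on (box (m.1 + (e_ i).1).+1 (m.2 + (e_ i).2).+1) f',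
      forall a, box m.1.+1 m.2.+1 a -> f' a = f a &
      forall a, box (e_ i).1.+1 (e_ i).2.+1 a ->
        f' (m.1%:Z + a.1, m.2%:Z + a.2) = h a].
  move: ri; rewrite -/h; move: h fh => h fh ri; clear glue rt r.
  move: ri; rewrite /e_; case: ifP => _ /= ri.
    by rewrite addn1 addn0; apply: extend_right.
  by rewrite addn1 addn0; apply: extend_up.
have [c pc] := isometries_vtype (set_mem (valP p)).
have p'i : @isometries B (shapeD m (e_ i)) (restrict_map (shapeD m (e_ i)) f').
  apply: (restrict_isometry (c := c)) => // a ha.
  have ha' : box m.1.+1 m.2.+1 a by apply: box_le ha.
  by rewrite f'f // pc.
exists (exist (fun p => p \in @isometries B (shapeD m (e_ i))) _ (mem_set p'i)).
split; apply/ffunP => l; rewrite windowE ?leq_addr //; have bl := pt_box l.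
  rewrite lift_restrict; last by move: bl; rewrite /box /=; lia.
  by rewrite !add0r -surjective_pairing f'f // /f lift_map_pt.
rewrite lift_restrict; last by move: bl; rewrite /box /=; lia.
by rewrite f'h // /h lift_map_pt.
Qed.

(** The letters of [w] and [u] match only up to the group. [extension_word_image] replaces the
    representative of [w] by one whose initial tile is the terminal tile of the chosen
    representative of [u], and these two can be glued. *)
Lemma word_mulP i (u w : word G) : sigma w = e_ i -> word_o w = word_t u ->
  is_product u w (word_mul u w).
Proof.
case: w => m c /= em; subst m; move=> ow.
have : (@extension_word i @` tile_extensions (terminal_tile (word_repr (tagged
  u))))
    (existT _ (e_ i) c).
  by rewrite extension_word_image.
move=> [r rT <-]; rewrite /word_mul.
have [p' [pE rE]] := product_exists rT.
suff : is_product u (extension_word r) (Tagged (words_of G) (word_class G p')).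
  by move=> H; exact: (xgetPex u (ex_intro _ _ H)).
exists p', (word_repr (tagged u)), r; split=> //; exact: word_reprK.
Qed.

Lemma product_shape (u w x : word G) : is_product u w x ->
  sigma x = shapeD (sigma u) (sigma w) /\ word_o x = word_o u.
Proof.
move=> [p' [p [r [pu pE _ _ ->]]]]; split=> //.
rewrite word_o_class; transitivity (word_class G (initial_tile p)).
  congr (word_class G _); apply: val_inj; apply/ffunP => l.
  rewrite !windowE // !add0r.
  have [l' <-] : exists l' : pvertex (sigma u), pt l' = pt l.
    by apply: box_pt; apply: box_le (pt_box l).
  by rewrite -surjective_pairing lift_map_pt pE windowE ?leq_addr // !add0r
    -surjective_pairing.
case: u p pu {pE r p'} => m c p /= pu; rewrite -[c]pu.
by rewrite word_o_class.
Qed.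

End Words.

Theorem proposition4p1 (R : realType) (q : nat) (B : building)
    (G : rotation_group B)
    (Bfin : locally_finite B) (Bthick : thick B) (Bq : of_order B q)
    (Gfree : acts_freely G) (Gfin : finitely_many_orbits G)
    (g : letter G -> R) (g_ge0 : forall v : letter G, 0 <= g v) :
  [/\ forall v : letter G, extend_weight q g (letter_word v) = g v,
      forall u : word G, 0 <= extend_weight q g u
    & forall (i : 'I_2) (u : word G),
        extend_weight q g u =
        \sum_(w \in [set w : word G | sigma w = e_ i /\ word_o w = word_t u])
           extend_weight q g (word_mul u w)].
Proof.
split=> [v|u|i u].
- rewrite /extend_weight /= muln0 expr0 invr1 mul1r; congr g.
  by rewrite -[v]word_reprK /letter_word word_o_class initial_tile_id.
- by rewrite /extend_weight mulr_ge0 // invr_ge0 exprn_ge0.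
have q0 : q%:R != 0 :> R by rewrite pnatr_eq0 -lt0n (building_order_gt0 Bq).
have cardA :=
  card_right_factors i (terminal_tile (word_repr (tagged u))) Bq Gfree.
set A := [set w | _] in cardA *.
have finA : finite_set A by exists (q * q)%N.
transitivity (\sum_(w \in A) (q%:R ^- 2 * extend_weight q g u)); last first.
  apply: eq_fsbigr => w; rewrite in_setE => -[sw ow].
  have [sx ox] := product_shape (word_mulP sw ow).
  (* Either shape [e_ i] raises the exponent of [q] by exactly 2. *)
  rewrite /extend_weight sx ox sw mulrA -invfM -exprD; congr (_ ^- _ * _).
  by rewrite /e_ /=; case: ifP => _ /=; lia.
rewrite fsbig_finite // big_const_seq count_predT.
have -> : size (fset_set A) = (q * q)%N by rewrite -(card_fset_set cardA).
rewrite iter_addr_0 -[RHS]mulr_natl mulrA natrM -expr2 mulfV ?mul1r //.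
by rewrite expf_neq0.
Qed.
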